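(* Let $k$ be a field, $H$ a finite dimensional Hopf algebra over $k$, $C$ a right $H$-module coalgebra, and $p:C\to\overline{C}=C/CH^+$ the canonical coalgebra epimorphism. If $p$ is coGalois, then $p$ is left and right codepth two.
   Context: Tensor products without subscript are over $k$, and Sweedler notation is used. A right $H$-module coalgebra is a $k$-coalgebra $C$ which is a right $H$-module such that $(ch)_{(1)}\otimes(ch)_{(2)}=c_{(1)}h_{(1)}\otimes c_{(2)}h_{(2)}$ and $\varepsilon_C(ch)=\varepsilon_C(c)\varepsilon_H(h)$ for all $c\in C$, $h\in H$. $H^+=\ker\varepsilon_H$, and $CH^+$ is a coideal of $C$. For a coalgebra homomorphism $g:C\to D$, $C$ is a $D$-$D$-bicomodule via $c\mapsto g(c_{(1)})\otimes c_{(2)}$ and $c\mapsto c_{(1)}\otimes g(c_{(2)})$. The cotensor product is $$C\,\Box_D\,C=\Big\{\textstyle\sum_i c_i\otimes c_i'\in C\otimes C:\ \sum_i c_{i(1)}\otimes g(c_{i(2)})\otimes c_i'=\sum_i c_i\otimes g(c'_{i(1)})\otimes c'_{i(2)}\Big\}.$$ It is a $C$-$C$-bicomodule via $\Delta\otimes\mathrm{id}_C$ (left coaction) and $\mathrm{id}_C\otimes\Delta$ (right coaction). By corestriction along $g$, $C$-comodules become $D$-comodules. The homomorphism $g$ is left codepth two if for some positive integer $N$ the cotensor product $C\,\Box_D\,C$ is isomorphic to a direct summand of $C^N$ as $D$-$C$-bicomodules. It is right codepth two if for some positive integer $N$, $C\,\Box_D\,C$ is isomorphic to a direct summand of $C^N$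 as $C$-$D$-bicomodules. The epimorphism $p:C\to\overline{C}$ is coGalois if the map $\mathrm{can}:C\otimes H\to C\,\Box_{\overline{C}}\,C$, $c\otimes h\mapsto c_{(1)}\otimes c_{(2)}h$, is bijective. *)

(* Defs.v *)
From HB Require Import structures.
From mathcomp Require Import all_boot all_order all_algebra all_field.
From mathcomp Require Import boolp classical_sets.

Set Implicit Arguments.
Unset Strict Implicit.
Unset Printing Implicit Defensive.

Import GRing.Theory.
Local Open Scope ring_scope.
Local Open Scope quotient_scope.

Reserved Notation "U ⊗ V" (at level 40, left associativity).
Reserved Notation "u ⊗ₜ v" (at level 40, left associativity).

(* The list [:: (u_1, v_1); ...; (u_n, v_n)] stands for the formal sum of the
   u_i ⊗ v_i. Additive inverses need no separate generators: (- u) ⊗ v is the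
   opposite of u ⊗ v by tensor_relDl and tensor_rel0. *)
Inductive tensor_rel (k : fieldType) (U V : lmodType k) :
    seq (U * V) -> seq (U * V) -> Prop :=
| tensor_rel_refl s : tensor_rel s s
| tensor_rel_sym s t : tensor_rel s t -> tensor_rel t s
| tensor_rel_trans s t r : tensor_rel s t -> tensor_rel t r -> tensor_rel s r
| tensor_rel_cat s s' t t' :
    tensor_rel s s' -> tensor_rel t t' -> tensor_rel (s ++ t) (s' ++ t')
| tensor_relC s t : tensor_rel (s ++ t) (t ++ s)
| tensor_relDl u u' v : tensor_rel [:: (u + u', v)] [:: (u, v); (u', v)]
| tensor_relDr u v v' : tensor_rel [:: (u, v + v')] [:: (u, v); (u, v')]
| tensor_relZ (a : k) u v : tensor_rel [:: (a *: u, v)] [:: (u, a *: v)]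
| tensor_rel0 v : tensor_rel [:: (0, v)] [::].

Section Tensor.
Variables (k : fieldType) (U V : lmodType k).
Implicit Types (s t : seq (U * V)) (a : k).

Definition tensor_eqb s t := `[< tensor_rel s t >].

Lemma tensor_eqb_refl : reflexive tensor_eqb.
Proof. by move=> s; apply/asboolP; exact: tensor_rel_refl. Qed.

Lemma tensor_eqb_sym : symmetric tensor_eqb.
Proof.
by move=> s t; apply/asboolP/asboolP => h; exact: tensor_rel_sym.
Qed.

Lemma tensor_eqb_trans : transitive tensor_eqb.
Proof.
move=> t s r /asboolP st /asboolP tr; apply/asboolP.
exact: tensor_rel_trans st tr.
Qed.

Canonical tensor_equiv :=
  EquivRel tensor_eqb tensor_eqb_refl tensor_eqb_sym tensor_eqb_trans.

Definition tensor := {eq_quot tensor_eqb}.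
HB.instance Definition _ := Choice.on tensor.

Definition tpi s : tensor := \pi_{eq_quot tensor_eqb} s.
Definition trepr (x : tensor) : seq (U * V) := repr x.

Lemma treprK x : tpi (trepr x) = x.
Proof. exact: reprK. Qed.

Lemma tpiP s t : tensor_rel s t -> tpi s = tpi t.
Proof. by move=> h; apply/eqmodP/asboolP. Qed.

Lemma tpi_rel s t : tpi s = tpi t -> tensor_rel s t.
Proof. by move=> /eqmodP/asboolP. Qed.

Lemma trepr_pi s : tensor_rel (trepr (tpi s)) s.
Proof. by apply: tpi_rel; rewrite treprK. Qed.

Definition tzero := tpi [::].
Definition tadd x y := tpi (trepr x ++ trepr y).
Definition scale_pairs a s := [seq (a *: p.1, p.2) | p <- s].
Definition tscale a x := tpi (scale_pairs a (trepr x)).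
Definition topp x := tscale (-1) x.

Lemma tadd_pi s t : tadd (tpi s) (tpi t) = tpi (s ++ t).
Proof. by apply: tpiP; apply: tensor_rel_cat; exact: trepr_pi. Qed.

Lemma scale_pairs_rel a s t :
  tensor_rel s t -> tensor_rel (scale_pairs a s) (scale_pairs a t).
Proof.
elim=> {s t} [s|s t _ IH|s t r _ IH1 _ IH2|s s' t t' _ IH1 _ IH2|s t
             |u u' v|u v v'|b u v|v].
- exact: tensor_rel_refl.
- exact: tensor_rel_sym.
- exact: tensor_rel_trans IH1 IH2.
- by rewrite /scale_pairs !map_cat; exact: tensor_rel_cat.
- by rewrite /scale_pairs !map_cat; exact: tensor_relC.
- by rewrite /= scalerDr; exact: tensor_relDl.
- exact: tensor_relDr.
- by rewrite /= scalerA mulrC -scalerA; exact: tensor_relZ.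
- by rewrite /= scaler0; exact: tensor_rel0.
Qed.

Lemma tscale_pi a s : tscale a (tpi s) = tpi (scale_pairs a s).
Proof. by apply: tpiP; apply: scale_pairs_rel; exact: trepr_pi. Qed.

Lemma taddA : associative tadd.
Proof.
move=> x y z; rewrite -(treprK x) -(treprK y) -(treprK z).
by rewrite !tadd_pi catA.
Qed.

Lemma taddC : commutative tadd.
Proof. by move=> x y; apply: tpiP; exact: tensor_relC. Qed.

Lemma tadd0 : left_id tzero tadd.
Proof. by move=> x; rewrite -(treprK x) tadd_pi. Qed.

Lemma tpi_cons p s : tpi (p :: s) = tadd (tpi [:: p]) (tpi s).
Proof. by rewrite tadd_pi. Qed.

Lemma tscaleDl x : {morph tscale^~ x : a b / a + b >-> tadd a b}.
Proof.
move=> a b; rewrite -(treprK x) !tscale_pi.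
elim: (trepr x) => [|[u v] s IH]; first by rewrite tadd_pi.
rewrite /= (tpi_cons _ (scale_pairs (a + b) s)) IH.
rewrite (tpi_cons _ (scale_pairs a s)) (tpi_cons _ (scale_pairs b s)).
rewrite scalerDl (tpiP (tensor_relDl _ _ _)) (tpi_cons _ [:: _]).
rewrite -!taddA; congr tadd; rewrite !taddA; congr tadd.
exact: taddC.
Qed.

Lemma tscale0 x : tscale 0 x = tzero.
Proof.
rewrite -(treprK x) !tscale_pi.
elim: (trepr x) => [|[u v] s IH]; first by [].
rewrite /= tpi_cons IH scale0r.
by rewrite (tpiP (tensor_rel0 U v)) tadd0.
Qed.

Lemma tscale1 : left_id 1 tscale.
Proof.
move=> x; rewrite -{2}(treprK x); congr tpi.
by rewrite -[RHS]map_id; apply: eq_map => -[u v] /=; rewrite scale1r.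
Qed.

Lemma taddN : left_inverse tzero topp tadd.
Proof. by move=> x; rewrite -{2}[x]tscale1 -tscaleDl addNr tscale0. Qed.

HB.instance Definition _ := GRing.isZmodule.Build tensor taddA taddC tadd0 taddN.

Lemma tscaleA a b x : tscale a (tscale b x) = tscale (a * b) x.
Proof.
rewrite -(treprK x) !tscale_pi; congr tpi; rewrite /scale_pairs -map_comp.
by apply: eq_map => -[u v] /=; rewrite scalerA.
Qed.

Lemma tscaleDr : right_distributive tscale tadd.
Proof.
move=> a x y; rewrite -(treprK x) -(treprK y).
by rewrite (tadd_pi (trepr x)) !tscale_pi tadd_pi /scale_pairs map_cat.
Qed.

HB.instance Definition _ := GRing.Zmodule_isLmodule.Build k tensor
  tscaleA tscale1 tscaleDr tscaleDl.

Definition tmul (u : U) (v : V) : tensor := tpi [:: (u, v)].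

Lemma tpiE s : tpi s = \sum_(p <- s) tmul p.1 p.2.
Proof.
elim: s => [|[u v] s IH]; first by rewrite big_nil.
by rewrite big_cons -IH tpi_cons.
Qed.

Lemma tmul_bilinear :
  ((forall v, linear (tmul^~ v)) * (forall u, linear (tmul u)))%type.
Proof.
have E a u v : a *: tmul u v = tmul (a *: u) v.
  by rewrite -[LHS]/(tscale _ _) tscale_pi.
split=> [v a u u'|u a v v'].
  rewrite E -[RHS]/(tadd _ _) tadd_pi.
  by apply: tpiP; exact: tensor_relDl.
rewrite E [tmul (a *: u) v](tpiP (tensor_relZ _ _ _)) -[RHS]/(tadd _ _) tadd_pi.
by apply: tpiP; exact: tensor_relDr.
Qed.
HB.instance Definition _ :=
  bilinear_isBilinear.Build k U V tensor _ _ tmul tmul_bilinear.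
HB.instance Definition _ u :=
  GRing.isLinear.Build k V tensor _ (tmul u) (tmul_bilinear.2 u).

Lemma tensor_span (x : tensor) :
  exists s : seq (U * V), x = \sum_(p <- s) tmul p.1 p.2.
Proof. by exists (trepr x); rewrite -tpiE treprK. Qed.

End Tensor.

Notation bilinear_map f :=
  ((forall v, linear (f^~ v)) * (forall u, linear (f u)))%type.
Notation "U ⊗ V" := (tensor U V).
Notation "u ⊗ₜ v" := (tmul u v).

Lemma tensor_ind (k : fieldType) (U V : lmodType k) (P : U ⊗ V -> Prop) :
  P 0 -> (forall u v, P (u ⊗ₜ v)) -> (forall x y, P x -> P y -> P (x + y)) ->
  forall x, P x.
Proof.
move=> P0 P1 PD x; have [s ->] := tensor_span x.
by elim/big_ind: _ => // -[].
Qed.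

Lemma tensor_ext (k : fieldType) (U V W : lmodType k)
    (f g : {linear U ⊗ V -> W}) :
  (forall u v, f (u ⊗ₜ v) = g (u ⊗ₜ v)) -> f =1 g.
Proof.
move=> fg; elim/tensor_ind => [|//|x y IHx IHy]; first by rewrite !linear0.
by rewrite !linearD IHx IHy.
Qed.

Section TensorLift.
Variables (k : fieldType) (U V W : lmodType k) (f : {bilinear U -> V -> W}).

Definition tlift (x : U ⊗ V) : W := \sum_(p <- trepr x) f p.1 p.2.

Lemma tlift_rel s t : tensor_rel s t ->
  \sum_(p <- s) f p.1 p.2 = \sum_(p <- t) f p.1 p.2.
Proof.
elim=> {s t} [//|//|s t r _ -> _ -> //|s s' t t' _ IH1 _ IH2|s t|u u' v|u v v'|a u v|v].
- by rewrite !big_cat IH1 IH2.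
- by rewrite !big_cat /= addrC.
- by rewrite !big_cons !big_nil /= !addr0 linearDl.
- by rewrite !big_cons !big_nil /= !addr0 linearDr.
- by rewrite !big_cons !big_nil /= !addr0 linearZl_LR linearZr_LR.
- by rewrite !big_cons !big_nil /= !addr0 linear0l.
Qed.

Lemma tlift_pi s : tlift (tpi s) = \sum_(p <- s) f p.1 p.2.
Proof. by apply: tlift_rel; exact: trepr_pi. Qed.

Lemma tlift_is_linear : linear tlift.
Proof.
move=> a x y; rewrite -(treprK x) -(treprK y).
rewrite -[a *: _]/(tscale _ _) -[_ + _]/(tadd _ _) tscale_pi tadd_pi !tlift_pi.
rewrite big_cat big_map scaler_sumr; congr (_ + _).
by apply: eq_bigr => p _; rewrite /= linearZl_LR.
Qed.
HB.instance Definition _ :=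
  GRing.isLinear.Build k (U ⊗ V) W _ tlift tlift_is_linear.

Lemma tliftE u v : tlift (u ⊗ₜ v) = f u v.
Proof. by rewrite tlift_pi big_cons big_nil addr0. Qed.

End TensorLift.

Section TensorMap.
Variables (k : fieldType) (U V U' V' : lmodType k).
Variables (f : {linear U -> U'}) (g : {linear V -> V'}).

Definition tmap_gen (u : U) (v : V) : U' ⊗ V' := f u ⊗ₜ g v.

Lemma tmap_gen_bilinear : bilinear_map tmap_gen.
Proof.
split=> [v a u u'|u a v v']; rewrite /tmap_gen linearP.
  by rewrite linearPl.
by rewrite linearPr.
Qed.
HB.instance Definition _ :=
  bilinear_isBilinear.Build k U V (U' ⊗ V') _ _ tmap_gen tmap_gen_bilinear.

Definition tmap : U ⊗ V -> U' ⊗ V' := tlift tmap_gen.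
HB.instance Definition _ := GRing.Linear.on tmap.

Lemma tmapE u v : tmap (u ⊗ₜ v) = f u ⊗ₜ g v.
Proof. exact: tliftE. Qed.

Lemma tmap0 : tmap 0 = 0. Proof. exact: linear0. Qed.
Lemma tmapD x y : tmap (x + y) = tmap x + tmap y. Proof. exact: linearD. Qed.

End TensorMap.

Section TensorAssoc.
Variables (k : fieldType) (U V W : lmodType k).

Definition tassoc_gen (x : U ⊗ V) (w : W) : U ⊗ (V ⊗ W) :=
  tmap idfun (applyr (@tmul k V W) w) x.

Lemma tassoc_gen_bilinear : bilinear_map tassoc_gen.
Proof.
split=> [w a x y|x a w w']; first by rewrite /tassoc_gen linearP.
rewrite /tassoc_gen; elim/tensor_ind: x => [|u v|x y IHx IHy].
- by rewrite !linear0 addr0.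
- by rewrite !tmapE /= linearPr linearPr.
- by rewrite !(linearD _ x) /= IHx IHy scalerDr addrACA.
Qed.
HB.instance Definition _ := bilinear_isBilinear.Build k (U ⊗ V) W (U ⊗ (V ⊗ W))
  _ _ tassoc_gen tassoc_gen_bilinear.

Definition tassoc : (U ⊗ V) ⊗ W -> U ⊗ (V ⊗ W) := tlift tassoc_gen.
HB.instance Definition _ := GRing.Linear.on tassoc.

Lemma tassocE u v w : tassoc ((u ⊗ₜ v) ⊗ₜ w) = u ⊗ₜ (v ⊗ₜ w).
Proof. by rewrite /tassoc tliftE /= /tassoc_gen tmapE. Qed.

End TensorAssoc.
Arguments tassoc {k U V W}.

Section TensorUnit.
Variables (k : fieldType) (V : lmodType k).

Definition scale_gen (a : k^o) (v : V) : V := a *: v.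
Definition scaler_gen (v : V) (a : k^o) : V := a *: v.

Lemma scale_gen_bilinear : bilinear_map scale_gen.
Proof.
split=> [v a b c|b a v w]; rewrite /scale_gen.
  by rewrite scalerDl scalerA.
by rewrite scalerDr !scalerA mulrC.
Qed.
HB.instance Definition _ := bilinear_isBilinear.Build k k^o V V
  _ _ scale_gen scale_gen_bilinear.

Lemma scaler_gen_bilinear : bilinear_map scaler_gen.
Proof.
by split=> [a b v w|v a b c];
  [exact: (scale_gen_bilinear.2)|exact: (scale_gen_bilinear.1)].
Qed.
HB.instance Definition _ := bilinear_isBilinear.Build k V k^o V
  _ _ scaler_gen scaler_gen_bilinear.

Definition tunitl : k^o ⊗ V -> V := tlift scale_gen.
HB.instance Definition _ := GRing.Linear.on tunitl.
Definition tunitr : V ⊗ k^o -> V := tlift scaler_gen.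
HB.instance Definition _ := GRing.Linear.on tunitr.

Lemma tunitlE a v : tunitl (a ⊗ₜ v) = a *: v.
Proof. exact: tliftE. Qed.
Lemma tunitrE v a : tunitr (v ⊗ₜ a) = a *: v.
Proof. exact: tliftE. Qed.

End TensorUnit.
Arguments tunitl {k V}.
Arguments tunitr {k V}.

Section TensorBimap.
Variables (k : fieldType) (U V W U' V' W' : lmodType k).
Variables (f : {bilinear U -> V -> W}) (f' : {bilinear U' -> V' -> W'}).

(* tbimap f f' (u ⊗ u') (v ⊗ v') = f u v ⊗ f' u' v', see tbimapE. *)
Definition tbimap_gen (y : V ⊗ V') (u : U) (u' : U') : W ⊗ W' :=
  tmap (f u) (f' u') y.

Lemma tbimap_gen_bilinear y : bilinear_map (tbimap_gen y).
Proof.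
rewrite /tbimap_gen; elim/tensor_ind: y => [|v v'|x y IHx IHy].
- by split=> [u' a u1 u2|u a u1 u2] /=; rewrite !tmap0 scaler0 addr0.
- by split=> [u' a u1 u2|u a u1 u2] /=; rewrite !tmapE /= ?linearPl ?linearPr.
- split=> [u' a u1 u2|u a u1 u2] /=; rewrite !tmapD.
    by rewrite IHx.1 IHy.1 scalerDr addrACA.
  by rewrite IHx.2 IHy.2 scalerDr addrACA.
Qed.
HB.instance Definition _ y := bilinear_isBilinear.Build k U U' (W ⊗ W')
  _ _ (tbimap_gen y) (tbimap_gen_bilinear y).

Definition tbimap (x : U ⊗ U') (y : V ⊗ V') : W ⊗ W' := tlift (tbimap_gen y) x.

Lemma tbimap_bilinear : bilinear_map tbimap.
Proof.
rewrite /tbimap; split=> [y a x x'|x a y y']; first by rewrite linearP.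
elim/tensor_ind: x => [|u u'|x x' IHx IHy].
- by rewrite !linear0 addr0.
- by rewrite !tliftE /= /tbimap_gen linearP.
- by rewrite !(linearD _ x) /= IHx IHy scalerDr addrACA.
Qed.
HB.instance Definition _ := bilinear_isBilinear.Build k (U ⊗ U') (V ⊗ V') (W ⊗ W')
  _ _ tbimap tbimap_bilinear.

Lemma tbimapE u u' v v' : tbimap (u ⊗ₜ u') (v ⊗ₜ v') = f u v ⊗ₜ f' u' v'.
Proof. by rewrite /tbimap tliftE /= /tbimap_gen tmapE. Qed.

End TensorBimap.


(* Linear maps on a subspace of a vector space extend to the whole space. *)
Lemma linear_factor (k : fieldType) (V W X : lmodType k)
    (f : {linear V -> W}) (g : {linear V -> X}) :
  (forall v, f v = 0 -> g v = 0) ->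
  exists h : {linear W -> X}, forall v, h (f v) = g v.
Proof.
move=> fg0.
pose good (G : set (W * X)) :=
  (forall (a : k) p q, G p -> G q -> G (a *: p + q)) /\
  (forall x, G (0, x) -> x = 0).
pose G0 : set (W * X) := [set (f v, g v) | v in setT]%classic.
have G0good : good G0.
  split=> [a _ _ [u _ <-] [v _ <-]|x [v _ [fv <-]]]; last exact: fg0.
  by exists (a *: u + v) => //; rewrite !linearP.
have [F FG0 Ftot|A [[Alin Afun] Amax]] :=
    @Zorn_bigcup (W * X)%type (fun A => good (G0 `|` A)%classic).
  have [[B FB]|F0] := pselect (exists B, F B); last first.
    suff -> : (\bigcup_(X0 in F) X0 = set0)%classic by rewrite setU0.
    by rewrite -subset0 => p [B FB _]; apply: F0; exists B.
  split=> [a p q|x]; last first.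
    case=> [G0x|[D FD Dx]]; first exact: G0good.2.
    by apply: (FG0 _ FD).2; right.
  have P r : (G0 `|` \bigcup_(X0 in F) X0)%classic r ->
      exists2 D, F D & (G0 `|` D)%classic r.
    by case=> [G0r|[D FD Dr]]; [exists B => //; left|exists D => //; right].
  move=> /P[D FD Dp] /P[E FE Eq].
  have sub D' : F D' -> (G0 `|` D' `<=` G0 `|` \bigcup_(X0 in F) X0)%classic.
    by move=> FD' r [G0r|D'r]; [left|right; exists D'].
  have [DE|ED] := Ftot _ _ FD FE.
    apply: (sub E) => //; apply: (FG0 _ FE).1 => //.
    by case: Dp => [?|/DE ?]; [left|right].
  apply: (sub D) => //; apply: (FG0 _ FD).1 => //.
  by case: Eq => [?|/ED ?]; [left|right].
set G := (G0 `|` A)%classic in Alin Afun.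
have G00 : G (0, 0) by left; exists 0; rewrite // !linear0.
have Gtot w : exists x, G (w, x).
  apply: contrapT => nG.
  pose B : set (W * X) :=
    [set p | exists (a : k) q, G q /\ p = (a *: w + q.1, q.2)]%classic.
  have GB : (G `<=` B)%classic.
    by move=> [w1 x1] Gp; exists 0, (w1, x1); rewrite scale0r add0r.
  apply: (Amax B).
    split=> [p Ap|BA]; first by apply: GB; right.
    apply: nG; exists 0; right; apply: BA.
    by exists 1, (0, 0); rewrite scale1r addr0.
  have -> : (G0 `|` B = B)%classic.
    by apply/setUidr => p G0p; apply: GB; left.
  split=> [a _ _ [b [p [Gp ->]]] [c [q [Gq ->]]]|x [a [[w1 x1] [Gq]]]] /=.
    exists (a * b + c), (a *: p + q); split; first exact: (Alin a p q Gp Gq).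
    congr (_, _) => /=.
    by rewrite scalerDr scalerDl scalerA addrACA.
  case=> /esym wE ->; have [a0|aN0] := eqVneq a 0.
    by move: wE Gq; rewrite a0 scale0r add0r => -> /Afun.
  case: nG; exists (- a^-1 *: x1).
  have -> : w = - a^-1 *: w1.
    apply: (scalerI aN0); rewrite scalerA mulrN divff // scaleN1r.
    by apply/eqP; rewrite -subr_eq0 opprK wE.
  by have := Alin (- a^-1) _ _ Gq G00; rewrite addr0.
have Guniq w x y : G (w, x) -> G (w, y) -> x = y.
  move=> Gx Gy; apply/eqP; rewrite -subr_eq0; apply/eqP/Afun.
  suff -> : (0, x - y) = -1 *: (w, y) + (w, x) :> W * X by exact: Alin.
  by apply: injective_projections; rewrite /= scaleN1r ?addNr // addrC.
pose h w := projT1 (cid (Gtot w)).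
have hG w : G (w, h w) by exact: (projT2 (cid (Gtot w))).
have hlin : linear h.
  by move=> a u v; apply: Guniq (hG _) (Alin a _ _ (hG u) (hG v)).
pose hM := GRing.isLinear.Build k W X _ h hlin.
pose hL : {linear W -> X} := HB.pack h hM.
by exists hL => v; apply: Guniq (hG _) _; left; exists v.
Qed.


Section TensorFunctor.
Variable k : fieldType.

Lemma tmap_id (U V : lmodType k) (x : U ⊗ V) : tmap idfun idfun x = x.
Proof.
by apply: (tensor_ext (f := tmap idfun idfun) (g := idfun)) => u v /=; rewrite tmapE.
Qed.

Lemma tmap_eq (U V U' V' : lmodType k) (f f' : {linear U -> U'})
    (g g' : {linear V -> V'}) :
  f =1 f' -> g =1 g' -> tmap f g =1 tmap f' g'.
Proof. by move=> ff gg; apply: tensor_ext => u v /=; rewrite !tmapE ff gg. Qed.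

Lemma tmap_comp (U V U' V' U'' V'' : lmodType k)
    (f : {linear U -> U'}) (g : {linear V -> V'})
    (f' : {linear U' -> U''}) (g' : {linear V' -> V''}) (x : U ⊗ V) :
  tmap f' g' (tmap f g x) = tmap (f' \o f) (g' \o g) x.
Proof.
apply: (tensor_ext (f := tmap f' g' \o tmap f g)) => u v /=.
by rewrite !tmapE.
Qed.

Lemma tmapBr (U V U' V' : lmodType k) (f : {linear U -> U'})
    (g g' : {linear V -> V'}) x :
  tmap f (g \- g') x = tmap f g x - tmap f g' x.
Proof.
apply: (tensor_ext (g := tmap f g \- tmap f g')) => u v /=.
by rewrite !tmapE /= linearBr.
Qed.

Lemma tmapBl (U V U' V' : lmodType k) (f f' : {linear U -> U'})
    (g : {linear V -> V'}) x :
  tmap (f \- f') g x = tmap f g x - tmap f' g x.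
Proof.
apply: (tensor_ext (g := tmap f g \- tmap f' g)) => u v /=.
by rewrite !tmapE /= linearBl.
Qed.

Lemma tassoc_nat (U V W U' V' W' : lmodType k) (f : {linear U -> U'})
    (g : {linear V -> V'}) (h : {linear W -> W'}) x :
  tassoc (tmap (tmap f g) h x) = tmap f (tmap g h) (tassoc x).
Proof.
elim/tensor_ind: x => [|y w|x y IHx IHy]; first by rewrite !linear0.
  elim/tensor_ind: y => [|u v|x y IHx IHy].
  - by rewrite linear0l !linear0.
  - by rewrite !tmapE /= tmapE !tassocE !tmapE /= tmapE.
  - by rewrite linearDl !linearD /= IHx IHy.
by rewrite !linearD /= IHx IHy.
Qed.

Lemma tunitl_nat (V W : lmodType k) (f : {linear V -> W}) x :
  tunitl (tmap idfun f x) = f (tunitl x).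
Proof.
apply: (tensor_ext (f := tunitl \o tmap idfun f) (g := f \o tunitl)) => a v /=.
by rewrite tmapE !tunitlE linearZ.
Qed.

Lemma tunitr_nat (V W : lmodType k) (f : {linear V -> W}) x :
  tunitr (tmap f idfun x) = f (tunitr x).
Proof.
apply: (tensor_ext (f := tunitr \o tmap f idfun) (g := f \o tunitr)) => v a /=.
by rewrite tmapE !tunitrE linearZ.
Qed.

End TensorFunctor.

Section TensorAssocInv.
Variables (k : fieldType) (U V W : lmodType k).

Definition tassocV_gen (u : U) (x : V ⊗ W) : (U ⊗ V) ⊗ W :=
  tmap (@tmul k U V u) idfun x.

Lemma tassocV_gen_bilinear : bilinear_map tassocV_gen.
Proof.
split=> [x a u u'|u a x y]; last by rewrite /tassocV_gen linearP.
rewrite /tassocV_gen; elim/tensor_ind: x => [|v w|x y IHx IHy].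
- by rewrite !tmap0 scaler0 addr0.
- by rewrite !tmapE /= linearPl linearPl.
- by rewrite !tmapD IHx IHy scalerDr addrACA.
Qed.
HB.instance Definition _ := bilinear_isBilinear.Build k U (V ⊗ W) ((U ⊗ V) ⊗ W)
  _ _ tassocV_gen tassocV_gen_bilinear.

Definition tassocV : U ⊗ (V ⊗ W) -> (U ⊗ V) ⊗ W := tlift tassocV_gen.
HB.instance Definition _ := GRing.Linear.on tassocV.

Lemma tassocVE u v w : tassocV (u ⊗ₜ (v ⊗ₜ w)) = (u ⊗ₜ v) ⊗ₜ w.
Proof. by rewrite /tassocV tliftE /= /tassocV_gen tmapE. Qed.

Lemma tassocK : cancel (@tassoc k U V W) tassocV.
Proof.
elim/tensor_ind=> [|x w|x y IHx IHy]; first by rewrite !linear0.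
  elim/tensor_ind: x => [|u v|x y IHx IHy].
  - by rewrite linear0l !linear0.
  - by rewrite tassocE tassocVE.
  - by rewrite linearDl !linearD /= IHx IHy.
by rewrite !linearD /= IHx IHy.
Qed.

Lemma tassocVK : cancel tassocV (@tassoc k U V W).
Proof.
elim/tensor_ind=> [|u x|x y IHx IHy]; first by rewrite !linear0.
  elim/tensor_ind: x => [|v w|x y IHx IHy].
  - by rewrite linear0r !linear0.
  - by rewrite tassocVE tassocE.
  - by rewrite linearDr !linearD /= IHx IHy.
by rewrite !linearD /= IHx IHy.
Qed.

End TensorAssocInv.
Arguments tassocV {k U V W}.

HB.mixin Record isCoalgebra (k : fieldType) C of GRing.Lmodule k C := {
  comul : {linear C -> C ⊗ C};
  counit : {linear C -> k^o};
  comulA : forall c,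
    tassoc (tmap comul idfun (comul c)) = tmap idfun comul (comul c);
  counitl : forall c, tunitl (tmap counit idfun (comul c)) = c;
  counitr : forall c, tunitr (tmap idfun counit (comul c)) = c
}.
#[short(type="coalgType")]
HB.structure Definition Coalgebra (k : fieldType) :=
  {C of GRing.Lmodule k C & isCoalgebra k C}.

Section AlgMul.
Variables (k : fieldType) (A : algType k).
Definition amul (a b : A) : A := a * b.
Lemma amul_bilinear : bilinear_map amul.
Proof.
split=> [b c a a'|a c b b']; rewrite /amul.
  by rewrite mulrDl scalerAl.
by rewrite mulrDr scalerAr.
Qed.
HB.instance Definition _ := bilinear_isBilinear.Build k A A A
  _ _ amul amul_bilinear.
End AlgMul.

HB.mixin Record isBialgebra (k : fieldType) H
    of GRing.Algebra k H & Coalgebra k H := {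
  comul1 : comul (1 : H) = 1 ⊗ₜ 1;
  comulM : forall g h : H,
    comul (g * h) = tbimap (@amul k H) (@amul k H) (comul g) (comul h);
  counit1 : counit (1 : H) = 1;
  counitM : forall g h : H, counit (g * h) = counit g * counit h
}.
#[short(type="bialgType")]
HB.structure Definition Bialgebra (k : fieldType) :=
  {H of GRing.Algebra k H & Coalgebra k H & isBialgebra k H}.

HB.mixin Record isHopfAlgebra (k : fieldType) H of Bialgebra k H := {
  antipode : {linear H -> H};
  antipodel : forall h : H,
    tlift (@amul k H) (tmap antipode idfun (comul h)) = (counit h : k) *: 1;
  antipoder : forall h : H,
    tlift (@amul k H) (tmap idfun antipode (comul h)) = (counit h : k) *: 1
}.
#[short(type="hopfAlgType")]
HB.structure Definition HopfAlgebra (k : fieldType) :=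
  {H of Bialgebra k H & isHopfAlgebra k H}.

#[short(type="finHopfAlgType")]
HB.structure Definition FinHopfAlgebra (k : fieldType) :=
  {H of Falgebra k H & HopfAlgebra k H}.

(* Right module coalgebras; ract c h is c h. *)
HB.mixin Record isModCoalgebra (k : fieldType) (H : hopfAlgType k) C
    of Coalgebra k C := {
  ract : {bilinear C -> H -> C};
  ract1 : forall c, ract c 1 = c;
  ractM : forall c g h, ract c (g * h) = ract (ract c g) h;
  comul_ract : forall c h,
    comul (ract c h) = tbimap ract ract (comul c) (comul h);
  counit_ract : forall c h, counit (ract c h) = counit c * counit h
}.
#[short(type="modCoalgType")]
HB.structure Definition ModCoalgebra (k : fieldType) (H : hopfAlgType k) :=
  {C of Coalgebra k C & isModCoalgebra k H C}.


Section QuotientModule.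
Variables (k : fieldType) (V : lmodType k) (I : submodClosed V).
Implicit Types x y : V.

Lemma modI_N x : (- x \in I) = (x \in I).
Proof.
by apply/idP/idP => Ix; [rewrite -[x]opprK|]; rewrite -scaleN1r rpredZ.
Qed.

Definition modI_eqb x y := x - y \in I.

Lemma modI_refl : reflexive modI_eqb.
Proof. by move=> x; rewrite /modI_eqb subrr rpred0. Qed.

Lemma modI_sym : symmetric modI_eqb.
Proof. by move=> x y; rewrite /modI_eqb -opprB modI_N. Qed.

Lemma modI_trans : transitive modI_eqb.
Proof.
by move=> y x z xy yz; rewrite /modI_eqb -(subrK y x) -addrA rpredD.
Qed.

Canonical modI_equiv := EquivRel modI_eqb modI_refl modI_sym modI_trans.

Definition quotmod := {eq_quot modI_eqb}.
HB.instance Definition _ := Choice.on quotmod.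

Definition qpi x : quotmod := \pi_{eq_quot modI_eqb} x.
Definition qrepr (q : quotmod) : V := repr q.

Lemma qreprK q : qpi (qrepr q) = q.
Proof. exact: reprK. Qed.

Lemma qpi_eqE x y : (qpi x == qpi y) = (x - y \in I).
Proof. by rewrite -[RHS]/(modI_eqb x y); apply/eqP/idP => /eqmodP. Qed.

Lemma qpiP x y : x - y \in I -> qpi x = qpi y.
Proof. by rewrite -qpi_eqE => /eqP. Qed.

Lemma qrepr_pi x : qrepr (qpi x) - x \in I.
Proof. by rewrite -qpi_eqE qreprK. Qed.

Definition qadd (q r : quotmod) := qpi (qrepr q + qrepr r).
Definition qopp (q : quotmod) := qpi (- qrepr q).
Definition qscale (a : k) (q : quotmod) := qpi (a *: qrepr q).

Lemma qadd_pi x y : qadd (qpi x) (qpi y) = qpi (x + y).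
Proof. by apply: qpiP; rewrite opprD addrACA rpredD ?qrepr_pi. Qed.

Lemma qopp_pi x : qopp (qpi x) = qpi (- x).
Proof. by apply: qpiP; rewrite -opprD modI_N qrepr_pi. Qed.

Lemma qscale_pi a x : qscale a (qpi x) = qpi (a *: x).
Proof. by apply: qpiP; rewrite -scalerBr rpredZ ?qrepr_pi. Qed.

Lemma qaddA : associative qadd.
Proof.
move=> q r s; rewrite -(qreprK q) -(qreprK r) -(qreprK s).
rewrite (qadd_pi (qrepr r)) (qadd_pi (qrepr q) (qrepr r)).
by rewrite (qadd_pi (qrepr q)) qadd_pi addrA.
Qed.

Lemma qaddC : commutative qadd.
Proof. by move=> q r; rewrite /qadd addrC. Qed.

Lemma qadd0 : left_id (qpi 0) qadd.
Proof. by move=> q; rewrite -(qreprK q) qadd_pi add0r. Qed.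

Lemma qaddN : left_inverse (qpi 0) qopp qadd.
Proof. by move=> q; rewrite -(qreprK q) qopp_pi qadd_pi addNr. Qed.

HB.instance Definition _ :=
  GRing.isZmodule.Build quotmod qaddA qaddC qadd0 qaddN.

Lemma qscaleA a b q : qscale a (qscale b q) = qscale (a * b) q.
Proof.
by rewrite -(qreprK q) (qscale_pi b) !qscale_pi scalerA.
Qed.

Lemma qscale1 : left_id 1 qscale.
Proof. by move=> q; rewrite -(qreprK q) qscale_pi scale1r. Qed.

Lemma qscaleDr : right_distributive qscale qadd.
Proof.
move=> a q r; rewrite -(qreprK q) -(qreprK r).
by rewrite (qadd_pi (qrepr q)) !qscale_pi qadd_pi scalerDr.
Qed.

Lemma qscaleDl q : {morph qscale^~ q : a b / a + b >-> qadd a b}.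
Proof.
by move=> a b; rewrite -(qreprK q) !qscale_pi qadd_pi scalerDl.
Qed.

HB.instance Definition _ := GRing.Zmodule_isLmodule.Build k quotmod
  qscaleA qscale1 qscaleDr qscaleDl.

Lemma qpi_is_linear : linear qpi.
Proof.
move=> a x y; rewrite -[RHS]/(qadd (qscale a (qpi x)) (qpi y)).
by rewrite qscale_pi qadd_pi.
Qed.
HB.instance Definition _ := GRing.isLinear.Build k V quotmod _ qpi qpi_is_linear.

Lemma qpi_eq0 x : (qpi x == 0) = (x \in I).
Proof. by rewrite qpi_eqE subr0. Qed.

Section Descent.
Variables (W : lmodType k) (f : {linear V -> W}).
Hypothesis fI : forall x, x \in I -> f x = 0.

Definition qlift of (forall x, x \in I -> f x = 0) := fun q => f (qrepr q).

Lemma qliftE x : qlift fI (qpi x) = f x.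
Proof.
apply/eqP; rewrite /qlift -subr_eq0 -linearB; apply/eqP/fI.
exact: qrepr_pi.
Qed.

Lemma qlift_is_linear : linear (qlift fI).
Proof.
move=> a q r; rewrite -(qreprK q) -(qreprK r).
by rewrite -linearP !qliftE linearP.
Qed.
HB.instance Definition _ :=
  GRing.isLinear.Build k quotmod W _ (qlift fI) qlift_is_linear.
End Descent.

End QuotientModule.

Record coalgHom (k : fieldType) (C D : coalgType k) := CoalgHom {
  coalgHom_fun :> {linear C -> D};
  comul_hom : forall c,
    comul (coalgHom_fun c) = tmap coalgHom_fun coalgHom_fun (comul c);
  counit_hom : forall c, counit (coalgHom_fun c) = counit c
}.

Section QuotientCoalgebra.
Variables (k : fieldType) (H : hopfAlgType k) (C : modCoalgType H).

Definition Hplus : {pred H} := [pred h | counit h == 0].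

Definition CHplus : {pred C} := fun c =>
  `[< exists2 s : seq (C * H), all (fun p => p.2 \in Hplus) s &
        c = \sum_(p <- s) ract p.1 p.2 >].

Lemma CHplus_submod_closed : submod_closed CHplus.
Proof.
split=> [|a u v]; first by apply/asboolP; exists [::]; rewrite ?big_nil.
move=> /asboolP[s sH ->] /asboolP[t tH ->]; apply/asboolP.
exists ([seq (a *: p.1, p.2) | p <- s] ++ t).
  by rewrite all_cat tH all_map andbT.
rewrite big_cat big_map scaler_sumr; congr (_ + _).
by apply: eq_bigr => p _; rewrite /= linearZl_LR.
Qed.
HB.instance Definition _ :=
  GRing.isSubmodClosed.Build k C CHplus CHplus_submod_closed.

Definition Cbar := quotmod CHplus.
HB.instance Definition _ := GRing.Lmodule.on Cbar.
Local Notation pi := (@qpi k C CHplus : {linear C -> Cbar}).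

Lemma pi_ract c h : pi (ract c h) = counit h *: pi c.
Proof.
rewrite -linearZ; apply/eqP; rewrite -subr_eq0 -linearB qpi_eq0.
apply/asboolP; exists [:: (c, h - (counit h : k) *: 1)].
  by rewrite /= andbT inE linearB linearZ /= counit1 /GRing.scale /= mulr1 subrr.
rewrite big_cons big_nil addr0 /=.
by rewrite linearBr linearZr_LR /= ract1.
Qed.

Lemma comul_CHplus c : c \in CHplus -> tmap pi pi (comul c) = 0.
Proof.
have tE (x : C ⊗ C) (y : H ⊗ H) : tmap pi pi (tbimap ract ract x y) =
    (tunitl (tmap counit counit y) : k) *: tmap pi pi x.
  elim/tensor_ind: x => [|c1 c2|x x' IHx IHx'].
  - by rewrite linear0l !linear0 ?scaler0.
  - elim/tensor_ind: y => [|h1 h2|y y' IHy IHy'].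
    + by rewrite linear0r !linear0 ?scale0r.
    + rewrite tbimapE !tmapE tunitlE !pi_ract.
      by rewrite linearZl_LR linearZr_LR /= scalerA.
    + by rewrite linearDr !linearD /= IHy IHy' scalerDl.
  - by rewrite linearDl !linearD /= IHx IHx' ?scalerDr.
move=> /asboolP[s sH ->]; rewrite !linear_sum big_seq big1 // => p ps /=.
rewrite comul_ract tE.
have -> : tmap counit counit (comul p.2) =
    tmap idfun counit (tmap counit idfun (comul p.2)).
  by rewrite tmap_comp; apply: tmap_eq.
rewrite tunitl_nat counitl.
by have /allP/(_ _ ps)/eqP -> := sH; rewrite scale0r.
Qed.

Lemma counit_CHplus c : c \in CHplus -> counit c = 0.
Proof.
move=> /asboolP[s sH ->]; rewrite linear_sum big_seq big1 // => p ps /=.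
by rewrite counit_ract; have /allP/(_ _ ps)/eqP -> := sH; rewrite mulr0.
Qed.

Definition comul_bar : Cbar -> Cbar ⊗ Cbar :=
  qlift (f := tmap pi pi \o comul) comul_CHplus.
HB.instance Definition _ := GRing.Linear.on comul_bar.
Definition counit_bar : Cbar -> k^o := qlift (f := counit) counit_CHplus.
HB.instance Definition _ := GRing.Linear.on counit_bar.

Lemma comul_barE c : comul_bar (pi c) = tmap pi pi (comul c).
Proof. exact: qliftE. Qed.
Lemma counit_barE c : counit_bar (pi c) = counit c.
Proof. exact: qliftE. Qed.

Lemma comul_barA (q : Cbar) : tassoc (tmap comul_bar idfun (comul_bar q)) =
  tmap idfun comul_bar (comul_bar q).
Proof.
rewrite -(qreprK q) comul_barE !tmap_comp.
have -> : tmap (comul_bar \o pi) (idfun \o pi) (comul (qrepr q)) =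
    tmap (tmap pi pi) pi (tmap comul idfun (comul (qrepr q))).
  by rewrite tmap_comp; apply: tmap_eq => // c /=; rewrite comul_barE.
rewrite tassoc_nat comulA tmap_comp; apply: tmap_eq => // c /=.
by rewrite comul_barE.
Qed.

Lemma counit_barl (q : Cbar) : tunitl (tmap counit_bar idfun (comul_bar q)) = q.
Proof.
rewrite -(qreprK q) comul_barE !tmap_comp.
have -> : tmap (counit_bar \o pi) (idfun \o pi) (comul (qrepr q)) =
    tmap idfun pi (tmap counit idfun (comul (qrepr q))).
  by rewrite tmap_comp; apply: tmap_eq => // c /=; rewrite counit_barE.
by rewrite tunitl_nat counitl.
Qed.

Lemma counit_barr (q : Cbar) : tunitr (tmap idfun counit_bar (comul_bar q)) = q.
Proof.
rewrite -(qreprK q) comul_barE !tmap_comp.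
have -> : tmap (idfun \o pi) (counit_bar \o pi) (comul (qrepr q)) =
    tmap pi idfun (tmap idfun counit (comul (qrepr q))).
  by rewrite tmap_comp; apply: tmap_eq => // c /=; rewrite counit_barE.
by rewrite tunitr_nat counitr.
Qed.

HB.instance Definition _ := isCoalgebra.Build k Cbar
  comul_barA counit_barl counit_barr.

Definition pbar : coalgHom C Cbar := CoalgHom comul_barE counit_barE.

Lemma pbar_eq0 c : (pbar c == 0) = (c \in CHplus).
Proof. exact: qpi_eq0. Qed.

Lemma pbar_surj (q : Cbar) : exists c, pbar c = q.
Proof. by exists (qrepr q); exact: qreprK. Qed.

End QuotientCoalgebra.
Arguments Hplus {k H}.
Arguments CHplus {k H} C.
Arguments Cbar {k H} C.
Arguments pbar {k H} C.


Record bicomodule (k : fieldType) (D E : coalgType k) := Bicomodule {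
  bicomod_sort :> lmodType k;
  lcoact : {linear bicomod_sort -> D ⊗ bicomod_sort};
  rcoact : {linear bicomod_sort -> bicomod_sort ⊗ E};
  lcoactA : forall m,
    tassoc (tmap comul idfun (lcoact m)) = tmap idfun lcoact (lcoact m);
  lcoact_counit : forall m, tunitl (tmap counit idfun (lcoact m)) = m;
  rcoactA : forall m,
    tassoc (tmap rcoact idfun (rcoact m)) = tmap idfun comul (rcoact m);
  rcoact_counit : forall m, tunitr (tmap idfun counit (rcoact m)) = m;
  lrcoactA : forall m,
    tassoc (tmap lcoact idfun (rcoact m)) = tmap idfun rcoact (lcoact m)
}.

Definition bicolinear (k : fieldType) (D E : coalgType k)
    (M N : bicomodule D E) (f : {linear M -> N}) : Prop :=
  (forall m, lcoact N (f m) = tmap idfun f (lcoact M m)) /\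
  (forall m, rcoact N (f m) = tmap f idfun (rcoact M m)).

Definition bicomod_iso (k : fieldType) (D E : coalgType k)
    (M N : bicomodule D E) : Prop :=
  exists f : {linear M -> N}, bicolinear f /\ bijective f.

Definition regular_bicomod (k : fieldType) (C : coalgType k) : bicomodule C C :=
  Bicomodule (@comulA k C) (@counitl k C) (@comulA k C) (@counitr k C)
    (@comulA k C).

Section Corestriction.
Variables (k : fieldType).

Section Left.
Variables (C D E : coalgType k) (g : coalgHom C D) (M : bicomodule C E).

Definition corestr_lcoact : {linear M -> D ⊗ M} := tmap g idfun \o lcoact M.

Lemma corestr_lcoactA m :
  tassoc (tmap comul idfun (corestr_lcoact m)) =
  tmap idfun corestr_lcoact (corestr_lcoact m).
Proof.
rewrite /= !tmap_comp.
have -> : tmap (comul \o g) (idfun \o idfun) (lcoact M m) =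
    tmap (tmap g g) idfun (tmap comul idfun (lcoact M m)).
  by rewrite tmap_comp; apply: tmap_eq => // c /=; rewrite comul_hom.
rewrite tassoc_nat lcoactA tmap_comp; apply: tmap_eq => // c /=.
Qed.

Lemma corestr_lcounit m : tunitl (tmap counit idfun (corestr_lcoact m)) = m.
Proof.
rewrite /= tmap_comp -[RHS]lcoact_counit; congr tunitl.
by apply: tmap_eq => // c /=; rewrite counit_hom.
Qed.

Lemma corestr_lrcoactA m :
  tassoc (tmap corestr_lcoact idfun (rcoact M m)) =
  tmap idfun (rcoact M) (corestr_lcoact m).
Proof.
have -> : tmap corestr_lcoact idfun (rcoact M m) =
    tmap (tmap g idfun) idfun (tmap (lcoact M) idfun (rcoact M m)).
  by rewrite tmap_comp; apply: tmap_eq.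
rewrite tassoc_nat lrcoactA /= !tmap_comp; apply: tmap_eq => // c /=.
by rewrite tmap_id.
Qed.

Definition corestrl : bicomodule D E := Bicomodule corestr_lcoactA
  corestr_lcounit (@rcoactA _ _ _ M) (@rcoact_counit _ _ _ M) corestr_lrcoactA.
End Left.

Section Right.
Variables (C D E : coalgType k) (g : coalgHom C D) (M : bicomodule E C).

Definition corestr_rcoact : {linear M -> M ⊗ D} := tmap idfun g \o rcoact M.

Lemma corestr_rcoactA m :
  tassoc (tmap corestr_rcoact idfun (corestr_rcoact m)) =
  tmap idfun comul (corestr_rcoact m).
Proof.
rewrite /= !tmap_comp.
have -> : tmap (corestr_rcoact \o idfun) (idfun \o g) (rcoact M m) =
    tmap (tmap idfun g) g (tmap (rcoact M) idfun (rcoact M m)).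
  by rewrite tmap_comp; apply: tmap_eq.
rewrite tassoc_nat rcoactA tmap_comp; apply: tmap_eq => // c /=.
by rewrite comul_hom.
Qed.

Lemma corestr_rcounit m : tunitr (tmap idfun counit (corestr_rcoact m)) = m.
Proof.
rewrite /= tmap_comp -[RHS]rcoact_counit; congr tunitr.
by apply: tmap_eq => // c /=; rewrite counit_hom.
Qed.

Lemma corestr_rlcoactA m :
  tassoc (tmap (lcoact M) idfun (corestr_rcoact m)) =
  tmap idfun corestr_rcoact (lcoact M m).
Proof.
have -> : tmap idfun corestr_rcoact (lcoact M m) =
    tmap idfun (tmap idfun g) (tmap idfun (rcoact M) (lcoact M m)).
  by rewrite tmap_comp; apply: tmap_eq.
rewrite -lrcoactA -tassoc_nat /= !tmap_comp; congr tassoc.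
by apply: tmap_eq => // c /=; rewrite tmap_id.
Qed.

Definition corestrr : bicomodule E D := Bicomodule (@lcoactA _ _ _ M)
  (@lcoact_counit _ _ _ M) corestr_rcoactA corestr_rcounit corestr_rlcoactA.
End Right.

End Corestriction.

Section DirectSum.
Variables (k : fieldType) (D E : coalgType k) (M N : bicomodule D E).

Definition dsum_inl (m : M) : M * N := (m, 0).
Definition dsum_inr (n : N) : M * N := (0, n).

Lemma dsum_inl_linear : linear dsum_inl.
Proof.
by move=> a x y; apply: injective_projections; rewrite //= scaler0 addr0.
Qed.
HB.instance Definition _ := GRing.isLinear.Build k M (M * N)%type _
  dsum_inl dsum_inl_linear.

Lemma dsum_inr_linear : linear dsum_inr.
Proof.
by move=> a x y; apply: injective_projections; rewrite //= scaler0 addr0.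
Qed.
HB.instance Definition _ := GRing.isLinear.Build k N (M * N)%type _
  dsum_inr dsum_inr_linear.

Lemma dsum_split (x : M * N) : dsum_inl x.1 + dsum_inr x.2 = x.
Proof. by apply: injective_projections; rewrite /= ?addr0 ?add0r. Qed.

Lemma dsum_ext (W : lmodType k) (f g : {linear (M * N)%type -> W}) :
  (forall m, f (dsum_inl m) = g (dsum_inl m)) ->
  (forall n, f (dsum_inr n) = g (dsum_inr n)) -> f =1 g.
Proof. by move=> fgM fgN x; rewrite -(dsum_split x) !linearD fgM fgN. Qed.

Definition dsum_lcoact (x : M * N) : D ⊗ (M * N)%type :=
  tmap idfun dsum_inl (lcoact M x.1) + tmap idfun dsum_inr (lcoact N x.2).
Definition dsum_rcoact (x : M * N) : (M * N)%type ⊗ E :=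
  tmap dsum_inl idfun (rcoact M x.1) + tmap dsum_inr idfun (rcoact N x.2).

Lemma dsum_lcoact_linear : linear dsum_lcoact.
Proof.
by move=> a x y; rewrite /dsum_lcoact !linearP /= scalerDr addrACA.
Qed.
HB.instance Definition _ := GRing.isLinear.Build k (M * N)%type _ _
  dsum_lcoact dsum_lcoact_linear.

Lemma dsum_rcoact_linear : linear dsum_rcoact.
Proof.
by move=> a x y; rewrite /dsum_rcoact !linearP /= scalerDr addrACA.
Qed.
HB.instance Definition _ := GRing.isLinear.Build k (M * N)%type _ _
  dsum_rcoact dsum_rcoact_linear.

Lemma dsum_lcoact_inl m : dsum_lcoact (dsum_inl m) = tmap idfun dsum_inl (lcoact M m).
Proof. by rewrite /dsum_lcoact /= !linear0 addr0. Qed.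
Lemma dsum_lcoact_inr n : dsum_lcoact (dsum_inr n) = tmap idfun dsum_inr (lcoact N n).
Proof. by rewrite /dsum_lcoact /= !linear0 add0r. Qed.
Lemma dsum_rcoact_inl m : dsum_rcoact (dsum_inl m) = tmap dsum_inl idfun (rcoact M m).
Proof. by rewrite /dsum_rcoact /= !linear0 addr0. Qed.
Lemma dsum_rcoact_inr n : dsum_rcoact (dsum_inr n) = tmap dsum_inr idfun (rcoact N n).
Proof. by rewrite /dsum_rcoact /= !linear0 add0r. Qed.

End DirectSum.

(* If j : M -> X commutes with candidate coactions on X, then the bicomodule
   axioms hold on the image of j. *)
Section ImageAxioms.
Variables (k : fieldType) (D E : coalgType k) (X : lmodType k).
Variables (lX : {linear X -> D ⊗ X}) (rX : {linear X -> X ⊗ E}).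
Variables (M : bicomodule D E) (j : {linear M -> X}).
Hypothesis lj : forall m, lX (j m) = tmap idfun j (lcoact M m).
Hypothesis rj : forall m, rX (j m) = tmap j idfun (rcoact M m).

Lemma im_lcoactA m :
  tassoc (tmap comul idfun (lX (j m))) = tmap idfun lX (lX (j m)).
Proof.
rewrite lj !tmap_comp.
have -> : tmap (comul \o idfun) (idfun \o j) (lcoact M m) =
    tmap (tmap idfun idfun) j (tmap comul idfun (lcoact M m)).
  by rewrite tmap_comp; apply: tmap_eq => // c /=; rewrite tmap_id.
rewrite tassoc_nat lcoactA tmap_comp; apply: tmap_eq => // c /=.
by rewrite lj.
Qed.

Lemma im_lcounit m : tunitl (tmap counit idfun (lX (j m))) = j m.
Proof.
rewrite lj tmap_comp -[in RHS](lcoact_counit m) -tunitl_nat tmap_comp.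
by congr tunitl; apply: tmap_eq.
Qed.

Lemma im_rcoactA m :
  tassoc (tmap rX idfun (rX (j m))) = tmap idfun comul (rX (j m)).
Proof.
rewrite rj !tmap_comp.
have -> : tmap (rX \o j) (idfun \o idfun) (rcoact M m) =
    tmap (tmap j idfun) idfun (tmap (rcoact M) idfun (rcoact M m)).
  by rewrite tmap_comp; apply: tmap_eq => // c /=; rewrite rj.
rewrite tassoc_nat rcoactA tmap_comp; apply: tmap_eq => // c /=.
by rewrite tmap_id.
Qed.

Lemma im_rcounit m : tunitr (tmap idfun counit (rX (j m))) = j m.
Proof.
rewrite rj tmap_comp -[in RHS](rcoact_counit m) -tunitr_nat tmap_comp.
by congr tunitr; apply: tmap_eq.
Qed.

Lemma im_lrcoactA m :
  tassoc (tmap lX idfun (rX (j m))) = tmap idfun rX (lX (j m)).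
Proof.
rewrite rj lj !tmap_comp.
have -> : tmap (lX \o j) (idfun \o idfun) (rcoact M m) =
    tmap (tmap idfun j) idfun (tmap (lcoact M) idfun (rcoact M m)).
  by rewrite tmap_comp; apply: tmap_eq => // c /=; rewrite lj.
rewrite tassoc_nat lrcoactA tmap_comp; apply: tmap_eq => // c /=.
by rewrite rj.
Qed.
End ImageAxioms.

Section DirectSumBicomod.
Variables (k : fieldType) (D E : coalgType k) (M N : bicomodule D E).
Local Notation lX := (@dsum_lcoact k D E M N).
Local Notation rX := (@dsum_rcoact k D E M N).
Let lM := @dsum_lcoact_inl k D E M N.
Let lN := @dsum_lcoact_inr k D E M N.
Let rM := @dsum_rcoact_inl k D E M N.
Let rN := @dsum_rcoact_inr k D E M N.

Lemma dsum_lcoactA x : tassoc (tmap comul idfun (lX x)) = tmap idfun lX (lX x).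
Proof.
apply: (dsum_ext (f := tassoc \o (tmap comul idfun \o lX))
  (g := tmap idfun lX \o lX)) => y.
  exact: (im_lcoactA lM).
exact: (im_lcoactA lN).
Qed.
Lemma dsum_lcounit x : tunitl (tmap counit idfun (lX x)) = x.
Proof.
apply: (dsum_ext (f := tunitl \o (tmap counit idfun \o lX)) (g := idfun)) => y.
  exact: (im_lcounit lM).
exact: (im_lcounit lN).
Qed.
Lemma dsum_rcoactA x : tassoc (tmap rX idfun (rX x)) = tmap idfun comul (rX x).
Proof.
apply: (dsum_ext (f := tassoc \o (tmap rX idfun \o rX))
  (g := tmap idfun comul \o rX)) => y.
  exact: (im_rcoactA rM).
exact: (im_rcoactA rN).
Qed.
Lemma dsum_rcounit x : tunitr (tmap idfun counit (rX x)) = x.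
Proof.
apply: (dsum_ext (f := tunitr \o (tmap idfun counit \o rX)) (g := idfun)) => y.
  exact: (im_rcounit rM).
exact: (im_rcounit rN).
Qed.
Lemma dsum_lrcoactA x : tassoc (tmap lX idfun (rX x)) = tmap idfun rX (lX x).
Proof.
apply: (dsum_ext (f := tassoc \o (tmap lX idfun \o rX))
  (g := tmap idfun rX \o lX)) => y.
  exact: (im_lrcoactA lM rM).
exact: (im_lrcoactA lN rN).
Qed.

Definition dsum : bicomodule D E := @Bicomodule k D E (M * N)%type lX rX
  dsum_lcoactA dsum_lcounit dsum_rcoactA dsum_rcounit dsum_lrcoactA.
End DirectSumBicomod.

Section Power.
Variables (k : fieldType) (D E : coalgType k) (M : bicomodule D E) (n : nat).
Local Notation X := {ffun 'I_n -> M}.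

Definition pow_in (i : 'I_n) (m : M) : X := [ffun j => if j == i then m else 0].

Lemma pow_in_linear i : linear (pow_in i).
Proof.
move=> a x y; apply/ffunP => j; rewrite !ffunE; case: ifP => // _.
by rewrite scaler0 addr0.
Qed.
HB.instance Definition _ i := GRing.isLinear.Build k M X _
  (pow_in i) (pow_in_linear i).

Lemma pow_split (x : X) : \sum_i pow_in i (x i) = x.
Proof.
apply/ffunP => j; rewrite sum_ffunE (bigD1 j) //= ffunE eqxx big1 ?addr0 //.
by move=> i ij; rewrite ffunE eq_sym (negPf ij).
Qed.

Lemma pow_ext (W : lmodType k) (f g : {linear X -> W}) :
  (forall i m, f (pow_in i m) = g (pow_in i m)) -> f =1 g.
Proof.
move=> fg x; rewrite -(pow_split x) !linear_sum.
by apply: eq_bigr => i _; exact: fg.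
Qed.

Definition pow_lcoact (x : X) : D ⊗ X :=
  \sum_i tmap idfun (pow_in i) (lcoact M (x i)).
Definition pow_rcoact (x : X) : X ⊗ E :=
  \sum_i tmap (pow_in i) idfun (rcoact M (x i)).

Lemma pow_lcoact_linear : linear pow_lcoact.
Proof.
move=> a x y; rewrite /pow_lcoact scaler_sumr -big_split; apply: eq_bigr => i _.
by rewrite !ffunE !linearP.
Qed.
HB.instance Definition _ := GRing.isLinear.Build k X _ _
  pow_lcoact pow_lcoact_linear.

Lemma pow_rcoact_linear : linear pow_rcoact.
Proof.
move=> a x y; rewrite /pow_rcoact scaler_sumr -big_split; apply: eq_bigr => i _.
by rewrite !ffunE !linearP.
Qed.
HB.instance Definition _ := GRing.isLinear.Build k X _ _
  pow_rcoact pow_rcoact_linear.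

Let lM i m : pow_lcoact (pow_in i m) = tmap idfun (pow_in i) (lcoact M m).
Proof.
rewrite /pow_lcoact (bigD1 i) //= ffunE eqxx big1 ?addr0 // => j ji.
by rewrite ffunE (negPf ji) !linear0.
Qed.
Let rM i m : pow_rcoact (pow_in i m) = tmap (pow_in i) idfun (rcoact M m).
Proof.
rewrite /pow_rcoact (bigD1 i) //= ffunE eqxx big1 ?addr0 // => j ji.
by rewrite ffunE (negPf ji) !linear0.
Qed.

Lemma pow_lcoactA x :
  tassoc (tmap comul idfun (pow_lcoact x)) = tmap idfun pow_lcoact (pow_lcoact x).
Proof.
apply: (pow_ext (f := tassoc \o (tmap comul idfun \o pow_lcoact))
  (g := tmap idfun pow_lcoact \o pow_lcoact)) => i m.
exact: (im_lcoactA (lM i)).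
Qed.
Lemma pow_lcounit x : tunitl (tmap counit idfun (pow_lcoact x)) = x.
Proof.
apply: (pow_ext (f := tunitl \o (tmap counit idfun \o pow_lcoact))
  (g := idfun)) => i m.
exact: (im_lcounit (lM i)).
Qed.
Lemma pow_rcoactA x :
  tassoc (tmap pow_rcoact idfun (pow_rcoact x)) = tmap idfun comul (pow_rcoact x).
Proof.
apply: (pow_ext (f := tassoc \o (tmap pow_rcoact idfun \o pow_rcoact))
  (g := tmap idfun comul \o pow_rcoact)) => i m.
exact: (im_rcoactA (rM i)).
Qed.
Lemma pow_rcounit x : tunitr (tmap idfun counit (pow_rcoact x)) = x.
Proof.
apply: (pow_ext (f := tunitr \o (tmap idfun counit \o pow_rcoact))
  (g := idfun)) => i m.
exact: (im_rcounit (rM i)).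
Qed.
Lemma pow_lrcoactA x :
  tassoc (tmap pow_lcoact idfun (pow_rcoact x)) =
  tmap idfun pow_rcoact (pow_lcoact x).
Proof.
apply: (pow_ext (f := tassoc \o (tmap pow_lcoact idfun \o pow_rcoact))
  (g := tmap idfun pow_rcoact \o pow_lcoact)) => i m.
exact: (im_lrcoactA (lM i) (rM i)).
Qed.

Definition bicomod_pow : bicomodule D E := @Bicomodule k D E X pow_lcoact
  pow_rcoact pow_lcoactA pow_lcounit pow_rcoactA pow_rcounit pow_lrcoactA.
End Power.

Definition direct_summand (k : fieldType) (D E : coalgType k)
    (M N : bicomodule D E) : Prop :=
  exists Z : bicomodule D E, bicomod_iso (dsum M Z) N.


Section Equalizer.
Variables (k : fieldType) (V W : lmodType k) (f g : {linear V -> W}).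

Definition eqz_pred : {pred V} := [pred v | f v == g v].

Lemma eqz_submod_closed : submod_closed eqz_pred.
Proof.
split=> [|a u v]; rewrite !inE ?linear0 // => /eqP fu /eqP fv.
by rewrite !linearP fu fv.
Qed.
HB.instance Definition _ :=
  GRing.isSubmodClosed.Build k V eqz_pred eqz_submod_closed.

Record equalizer := Equalizer { eqz_val : V; eqz_valP : eqz_val \in eqz_pred }.
HB.instance Definition _ := [isSub for eqz_val].
HB.instance Definition _ := [Choice of equalizer by <:].
HB.instance Definition _ := [SubChoice_isSubLmodule of equalizer by <:].

Lemma eqz_val_linear : linear eqz_val.
Proof. by move=> a x y; exact: (linearP (val : {linear equalizer -> V})). Qed.
HB.instance Definition _ := GRing.isLinear.Build k equalizer V _
  eqz_val eqz_val_linear.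

Lemma eqzP (x : equalizer) : f (eqz_val x) = g (eqz_val x).
Proof. exact/eqP/eqz_valP. Qed.

Lemma eqz_retract_ex :
  exists r : {linear V -> equalizer}, forall x, r (eqz_val x) = x.
Proof.
have [|r rE] := @linear_factor k equalizer V equalizer eqz_val idfun; last first.
  by exists r.
by move=> x x0; apply: val_inj; rewrite /= x0.
Qed.
Definition eqz_retract : {linear V -> equalizer} := projT1 (cid eqz_retract_ex).
Lemma eqz_retractK x : eqz_retract (eqz_val x) = x.
Proof. exact: (projT2 (cid eqz_retract_ex)). Qed.

Lemma eqz_factor_ex : exists h : {linear W -> V},
  forall v, h ((f \- g) v) = (idfun \- (eqz_val \o eqz_retract)) v.
Proof.
apply: linear_factor => v /= /eqP; rewrite subr_eq0 => fgv.
by rewrite -{2}[v]/(eqz_val (Equalizer fgv)) eqz_retractK subrr.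
Qed.

(* Exactness of the tensor product over a field. *)
Lemma tmap_eqzr (U : lmodType k) (t : U ⊗ V) : tmap idfun f t = tmap idfun g t ->
  tmap idfun eqz_val (tmap idfun eqz_retract t) = t.
Proof.
move=> fgt; have [h hE] := eqz_factor_ex.
apply/eqP; rewrite eq_sym -subr_eq0; apply/eqP.
have := tmapBr idfun idfun (eqz_val \o eqz_retract) t.
rewrite tmap_id tmap_comp => <-.
have -> : tmap idfun (idfun \- (eqz_val \o eqz_retract)) t =
    tmap idfun h (tmap idfun (f \- g) t).
  by rewrite tmap_comp; apply: tmap_eq => // v; rewrite -[LHS]hE.
by rewrite tmapBr fgt subrr linear0.
Qed.

Lemma tmap_eqzl (U : lmodType k) (t : V ⊗ U) : tmap f idfun t = tmap g idfun t ->
  tmap eqz_val idfun (tmap eqz_retract idfun t) = t.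
Proof.
move=> fgt; have [h hE] := eqz_factor_ex.
apply/eqP; rewrite eq_sym -subr_eq0; apply/eqP.
have := tmapBl idfun (eqz_val \o eqz_retract) idfun t.
rewrite tmap_id tmap_comp => <-.
have -> : tmap (idfun \- (eqz_val \o eqz_retract)) idfun t =
    tmap h idfun (tmap (f \- g) idfun t).
  by rewrite tmap_comp; apply: tmap_eq => // v; rewrite -[LHS]hE.
by rewrite tmapBl fgt subrr linear0.
Qed.

End Equalizer.

(* If a split monomorphism i : K -> M commutes with candidate coactions on K,
   then K satisfies the bicomodule axioms. *)
Section SplitMono.
Variables (k : fieldType) (D E : coalgType k) (M : bicomodule D E).
Variables (K : lmodType k) (i : {linear K -> M}) (r : {linear M -> K}).
Variables (lK : {linear K -> D ⊗ K}) (rK : {linear K -> K ⊗ E}).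
Hypothesis iK : cancel i r.
Hypothesis lKE : forall x, tmap idfun i (lK x) = lcoact M (i x).
Hypothesis rKE : forall x, tmap i idfun (rK x) = rcoact M (i x).

Lemma split_lcoactA x :
  tassoc (tmap comul idfun (lK x)) = tmap idfun lK (lK x).
Proof.
have inj : injective (tmap (@idfun D) (tmap (@idfun D) i)).
  apply: (can_inj (g := tmap idfun (tmap idfun r))) => t.
  rewrite tmap_comp -[RHS]tmap_id; apply: tmap_eq => // y /=.
  rewrite tmap_comp -[RHS]tmap_id; apply: tmap_eq => // z /=.
apply: inj; rewrite -tassoc_nat !tmap_comp.
have -> : tmap (tmap idfun idfun \o comul) (i \o idfun) (lK x) =
    tmap comul idfun (tmap idfun i (lK x)).
  by rewrite tmap_comp; apply: tmap_eq => // c /=; rewrite tmap_id.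
rewrite lKE lcoactA -lKE tmap_comp.
by apply: tmap_eq => // y /=; rewrite -lKE.
Qed.

Lemma split_lcounit x : tunitl (tmap counit idfun (lK x)) = x.
Proof.
apply: (can_inj iK).
rewrite -[RHS]lcoact_counit -lKE -tunitl_nat !tmap_comp.
by congr tunitl; apply: tmap_eq.
Qed.

Lemma split_rcoactA x :
  tassoc (tmap rK idfun (rK x)) = tmap idfun comul (rK x).
Proof.
have inj : injective (tmap i (tmap (@idfun E) (@idfun E))).
  apply: (can_inj (g := tmap r idfun)) => t.
  rewrite tmap_comp -[RHS]tmap_id; apply: tmap_eq => // y /=.
  by rewrite tmap_id.
apply: inj; rewrite -tassoc_nat !tmap_comp.
have -> : tmap (tmap i idfun \o rK) (idfun \o idfun) (rK x) =
    tmap (rcoact M) idfun (tmap i idfun (rK x)).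
  by rewrite tmap_comp; apply: tmap_eq => // y /=; rewrite -rKE.
rewrite rKE rcoactA -rKE tmap_comp.
by apply: tmap_eq => // y /=; rewrite tmap_id.
Qed.

Lemma split_rcounit x : tunitr (tmap idfun counit (rK x)) = x.
Proof.
apply: (can_inj iK).
rewrite -[RHS]rcoact_counit -rKE -tunitr_nat !tmap_comp.
by congr tunitr; apply: tmap_eq.
Qed.

Lemma split_lrcoactA x :
  tassoc (tmap lK idfun (rK x)) = tmap idfun rK (lK x).
Proof.
have inj : injective (tmap (@idfun D) (tmap i (@idfun E))).
  apply: (can_inj (g := tmap idfun (tmap r idfun))) => t.
  rewrite tmap_comp -[RHS]tmap_id; apply: tmap_eq => // y /=.
  rewrite tmap_comp -[RHS]tmap_id; apply: tmap_eq => // z /=.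
apply: inj; rewrite -tassoc_nat !tmap_comp.
have -> : tmap (tmap idfun i \o lK) (idfun \o idfun) (rK x) =
    tmap (lcoact M) idfun (tmap i idfun (rK x)).
  by rewrite tmap_comp; apply: tmap_eq => // y /=; rewrite -lKE.
rewrite rKE lrcoactA -lKE tmap_comp.
by apply: tmap_eq => // y /=; rewrite -rKE.
Qed.
End SplitMono.

Section SubBicomodule.
Variables (k : fieldType) (D E : coalgType k) (M : bicomodule D E).
Variables (W : lmodType k) (f g : {linear M -> W}).
Hypothesis lfg : forall m, f m = g m ->
  tmap idfun f (lcoact M m) = tmap idfun g (lcoact M m).
Hypothesis rfg : forall m, f m = g m ->
  tmap f idfun (rcoact M m) = tmap g idfun (rcoact M m).
Local Notation K := (equalizer f g).
Local Notation i := (@eqz_val k M W f g).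
Local Notation r := (eqz_retract f g).

(* The coactions do not depend on the choice of the retraction r; they are
   characterized by eqz_lcoactE and eqz_rcoactE. *)
Definition eqz_lcoact : {linear K -> D ⊗ K} := tmap idfun r \o (lcoact M \o i).
Definition eqz_rcoact : {linear K -> K ⊗ E} := tmap r idfun \o (rcoact M \o i).

Lemma eqz_lcoactE x : tmap idfun i (eqz_lcoact x) = lcoact M (i x).
Proof. by apply: tmap_eqzr; apply/lfg/eqzP. Qed.
Lemma eqz_rcoactE x : tmap i idfun (eqz_rcoact x) = rcoact M (i x).
Proof. by apply: tmap_eqzl; apply/rfg/eqzP. Qed.

Let iK := @eqz_retractK k M W f g.
Definition eqz_bicomod : bicomodule D E := Bicomodule
  (split_lcoactA iK eqz_lcoactE) (split_lcounit iK eqz_lcoactE)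
  (split_rcoactA iK eqz_rcoactE) (split_rcounit iK eqz_rcoactE)
  (split_lrcoactA iK eqz_lcoactE eqz_rcoactE).

End SubBicomodule.

Section Square.
Variables (k : fieldType) (C : coalgType k).

(* C ⊗ C as a C-C-bicomodule via Δ ⊗ id and id ⊗ Δ. *)
Definition sq_lcoact : {linear C ⊗ C -> C ⊗ (C ⊗ C)} :=
  tassoc \o tmap comul idfun.
Definition sq_rcoact : {linear C ⊗ C -> (C ⊗ C) ⊗ C} :=
  tassocV \o tmap idfun comul.

Lemma tassoc_tmulr (U V W : lmodType k) (x : U ⊗ V) (w : W) :
  tassoc (x ⊗ₜ w) = tmap idfun (applyr (@tmul k V W) w) x.
Proof. by rewrite /tassoc tliftE. Qed.

Lemma tassocV_tmull (U V W : lmodType k) (u : U) (x : V ⊗ W) :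
  tassocV (u ⊗ₜ x) = tmap (@tmul k U V u) idfun x.
Proof. by rewrite /tassocV tliftE. Qed.

Lemma tassoc_tassocV (U V W X : lmodType k) (z : (U ⊗ V) ⊗ (W ⊗ X)) :
  tassoc (tmap tassoc idfun (tassocV z)) = tmap idfun tassocV (tassoc z).
Proof.
elim/tensor_ind: z => [|x y|z z' IHz IHz']; first by rewrite !linear0.
  elim/tensor_ind: x => [|u v|x x' IHx IHx'].
  - by rewrite !linear0l !linear0.
  - elim/tensor_ind: y => [|w t|y y' IHy IHy'].
    + by rewrite !linear0r !linear0.
    + by rewrite tassocVE tmapE /= !tassocE tmapE /= tassocVE.
    + by rewrite linearDr !linearD /= IHy IHy'.
  - by rewrite linearDl !linearD /= IHx IHx'.
by rewrite !linearD /= IHz IHz'.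
Qed.

Lemma sq_lcoactE a b :
  sq_lcoact (a ⊗ₜ b) = tmap idfun (applyr (@tmul k C C) b) (comul a).
Proof. by rewrite /sq_lcoact /= tmapE tassoc_tmulr. Qed.

Lemma sq_rcoactE a b : sq_rcoact (a ⊗ₜ b) = tmap (@tmul k C C a) idfun (comul b).
Proof. by rewrite /sq_rcoact /= tmapE tassocV_tmull. Qed.

Lemma sq_lcoactA t :
  tassoc (tmap comul idfun (sq_lcoact t)) = tmap idfun sq_lcoact (sq_lcoact t).
Proof.
apply: (tensor_ext (f := tassoc \o (tmap comul idfun \o sq_lcoact))
  (g := tmap idfun sq_lcoact \o sq_lcoact)) => a b.
rewrite -[LHS]/(tassoc (tmap comul idfun (sq_lcoact (a ⊗ₜ b)))).
rewrite -[RHS]/(tmap idfun sq_lcoact (sq_lcoact (a ⊗ₜ b))).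
rewrite sq_lcoactE !tmap_comp.
have -> : tmap (comul \o idfun) (idfun \o applyr (@tmul k C C) b) (comul a) =
    tmap (tmap idfun idfun) (applyr (@tmul k C C) b)
      (tmap comul idfun (comul a)).
  by rewrite tmap_comp; apply: tmap_eq => // c /=; rewrite tmap_id.
rewrite tassoc_nat comulA tmap_comp; apply: tmap_eq => // c.
by rewrite -[RHS]/(sq_lcoact (c ⊗ₜ b)) sq_lcoactE.
Qed.

Lemma sq_lcounit t : tunitl (tmap counit idfun (sq_lcoact t)) = t.
Proof.
apply: (tensor_ext (f := tunitl \o (tmap counit idfun \o sq_lcoact))
  (g := idfun)) => a b.
rewrite -[LHS]/(tunitl (tmap counit idfun (sq_lcoact (a ⊗ₜ b)))).
rewrite sq_lcoactE tmap_comp.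
have -> : tmap (counit \o idfun) (idfun \o applyr (@tmul k C C) b) (comul a) =
    tmap idfun (applyr (@tmul k C C) b) (tmap counit idfun (comul a)).
  by rewrite tmap_comp; apply: tmap_eq.
by rewrite tunitl_nat counitl.
Qed.

Lemma sq_rcoactA t :
  tassoc (tmap sq_rcoact idfun (sq_rcoact t)) = tmap idfun comul (sq_rcoact t).
Proof.
apply: (tensor_ext (f := tassoc \o (tmap sq_rcoact idfun \o sq_rcoact))
  (g := tmap idfun comul \o sq_rcoact)) => a b.
rewrite -[LHS]/(tassoc (tmap sq_rcoact idfun (sq_rcoact (a ⊗ₜ b)))).
rewrite -[RHS]/(tmap idfun comul (sq_rcoact (a ⊗ₜ b))).
rewrite sq_rcoactE !tmap_comp.
have -> : tmap (sq_rcoact \o tmul a) (idfun \o idfun) (comul b) =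
    tmap (tmap (tmul a) idfun) idfun (tmap comul idfun (comul b)).
  by rewrite tmap_comp; apply: tmap_eq => // c; exact: sq_rcoactE.
rewrite tassoc_nat comulA tmap_comp; apply: tmap_eq => // c /=.
by rewrite tmap_id.
Qed.

Lemma sq_rcounit t : tunitr (tmap idfun counit (sq_rcoact t)) = t.
Proof.
apply: (tensor_ext (f := tunitr \o (tmap idfun counit \o sq_rcoact))
  (g := idfun)) => a b.
rewrite -[LHS]/(tunitr (tmap idfun counit (sq_rcoact (a ⊗ₜ b)))).
rewrite sq_rcoactE tmap_comp.
have -> : tmap (idfun \o tmul a) (counit \o idfun) (comul b) =
    tmap (@tmul k C C a) idfun (tmap idfun counit (comul b)).
  by rewrite tmap_comp; apply: tmap_eq.
by rewrite tunitr_nat counitr.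
Qed.

Lemma sq_lrcoactA t :
  tassoc (tmap sq_lcoact idfun (sq_rcoact t)) = tmap idfun sq_rcoact (sq_lcoact t).
Proof.
apply: (tensor_ext (f := tassoc \o (tmap sq_lcoact idfun \o sq_rcoact))
  (g := tmap idfun sq_rcoact \o sq_lcoact)) => a b.
rewrite -[LHS]/(tassoc (tmap sq_lcoact idfun (sq_rcoact (a ⊗ₜ b)))).
rewrite -[RHS]/(tmap idfun sq_rcoact (sq_lcoact (a ⊗ₜ b))).
rewrite sq_rcoactE sq_lcoactE !tmap_comp.
have -> : tmap (sq_lcoact \o tmul a) (idfun \o idfun) (comul b) =
    tmap tassoc idfun (tassocV (comul a ⊗ₜ comul b)).
  rewrite tassocV_tmull tmap_comp; apply: tmap_eq => // c /=.
  by rewrite tmapE.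
rewrite tassoc_tassocV tassoc_tmulr tmap_comp; apply: tmap_eq => // c /=.
by rewrite tmapE.
Qed.

Definition sq_bicomod : bicomodule C C := Bicomodule sq_lcoactA sq_lcounit
  sq_rcoactA sq_rcounit sq_lrcoactA.

End Square.

Section Cotensor.
Variables (k : fieldType) (C D : coalgType k) (g : coalgHom C D).

(* cot_l (c ⊗ c') = c_(1) ⊗ g c_(2) ⊗ c' and
   cot_r (c ⊗ c') = c ⊗ g c'_(1) ⊗ c'_(2). *)
Definition cot_l : {linear C ⊗ C -> C ⊗ (D ⊗ C)} :=
  tassoc \o tmap (tmap idfun g \o comul) idfun.
Definition cot_r : {linear C ⊗ C -> C ⊗ (D ⊗ C)} :=
  tmap idfun (tmap g idfun \o comul).

Lemma cot_lE a b : cot_l (a ⊗ₜ b) =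
  tmap idfun (applyr (@tmul k D C) b) (tmap idfun g (comul a)).
Proof. by rewrite /cot_l /= tmapE tassoc_tmulr. Qed.

Definition cot_mid_lcoact : {linear C ⊗ (D ⊗ C) -> C ⊗ (C ⊗ (D ⊗ C))} :=
  tassoc \o tmap comul idfun.
Definition cot_mid_rcoact : {linear C ⊗ (D ⊗ C) -> (C ⊗ (D ⊗ C)) ⊗ C} :=
  tassocV \o tmap idfun (tassocV \o tmap idfun comul).

Lemma cot_l_lcoact t :
  tmap idfun cot_l (sq_lcoact C t) = cot_mid_lcoact (cot_l t).
Proof.
apply: (tensor_ext (f := tmap idfun cot_l \o @sq_lcoact k C)
  (g := cot_mid_lcoact \o cot_l)) => a b.
rewrite -[LHS]/(tmap idfun cot_l (sq_lcoact C (a ⊗ₜ b))).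
rewrite -[RHS]/(cot_mid_lcoact (cot_l (a ⊗ₜ b))).
rewrite sq_lcoactE cot_lE /cot_mid_lcoact /= !tmap_comp.
have -> : tmap (comul \o (idfun \o idfun))
    (idfun \o (applyr (@tmul k D C) b \o g)) (comul a) =
    tmap (tmap idfun idfun) (applyr (@tmul k D C) b \o g)
      (tmap comul idfun (comul a)).
  by rewrite tmap_comp; apply: tmap_eq => // c /=; rewrite tmap_id.
rewrite tassoc_nat comulA tmap_comp; apply: tmap_eq => // c.
by rewrite -[LHS]/(cot_l (c ⊗ₜ b)) cot_lE /= tmap_comp.
Qed.

Lemma cot_r_lcoact t :
  tmap idfun cot_r (sq_lcoact C t) = cot_mid_lcoact (cot_r t).
Proof.
rewrite /cot_r /sq_lcoact /cot_mid_lcoact /= -tassoc_nat !tmap_comp.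
by congr tassoc; apply: tmap_eq => // c /=; rewrite tmap_id.
Qed.

Lemma tassocV_nat (U V W U' V' W' : lmodType k) (f : {linear U -> U'})
    (f' : {linear V -> V'}) (f'' : {linear W -> W'}) x :
  tassocV (tmap f (tmap f' f'') x) = tmap (tmap f f') f'' (tassocV x).
Proof.
by apply: (can_inj (@tassocK _ _ _ _)); rewrite tassoc_nat !tassocVK.
Qed.

Lemma cot_l_rcoact t :
  tmap cot_l idfun (sq_rcoact C t) = cot_mid_rcoact (cot_l t).
Proof.
pose A : {linear C -> C ⊗ D} := tmap idfun g \o comul.
have -> : cot_mid_rcoact (cot_l t) =
    tassocV (tmap idfun tassocV (tassoc (tmap A comul t))).
  have -> : tmap A comul t = tmap (tmap idfun idfun) comul (tmap A idfun t).
    by rewrite tmap_comp; apply: tmap_eq => // c /=; rewrite tmap_id.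
  by rewrite tassoc_nat tmap_comp.
rewrite -tassoc_tassocV tassocK.
have -> : tmap A comul t = tmap A (tmap idfun idfun) (tmap idfun comul t).
  by rewrite tmap_comp; apply: tmap_eq => // c /=; rewrite tmap_id.
by rewrite tassocV_nat tmap_comp.
Qed.

Lemma cot_r_rcoact t :
  tmap cot_r idfun (sq_rcoact C t) = cot_mid_rcoact (cot_r t).
Proof.
pose B : {linear C -> D ⊗ C} := tmap g idfun \o comul.
have BE c : tmap B idfun (comul c) = tassocV (tmap idfun comul (B c)).
  have -> : tmap B idfun (comul c) =
      tmap (tmap g idfun) idfun (tmap comul idfun (comul c)).
    by rewrite tmap_comp; apply: tmap_eq.
  rewrite -(tassocK (tmap comul idfun _)) comulA -tassocV_nat.
  rewrite /B /= !tmap_comp; congr tassocV; apply: tmap_eq => // d /=.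
  by rewrite tmap_id.
rewrite -[LHS]/(tmap (tmap idfun B) idfun (tassocV (tmap idfun comul t))).
rewrite -tassocV_nat tmap_comp.
rewrite -[RHS]/(tassocV (tmap idfun (tassocV \o tmap idfun comul)
  (tmap idfun B t))).
by rewrite tmap_comp; congr tassocV; apply: tmap_eq => // c; exact: BE.
Qed.

Lemma cot_lstable t : cot_l t = cot_r t ->
  tmap idfun cot_l (lcoact (sq_bicomod C) t) =
  tmap idfun cot_r (lcoact (sq_bicomod C) t).
Proof. by move=> tE; rewrite [LHS]cot_l_lcoact [RHS]cot_r_lcoact tE. Qed.

Lemma cot_rstable t : cot_l t = cot_r t ->
  tmap cot_l idfun (rcoact (sq_bicomod C) t) =
  tmap cot_r idfun (rcoact (sq_bicomod C) t).
Proof. by move=> tE; rewrite [LHS]cot_l_rcoact [RHS]cot_r_rcoact tE. Qed.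

(* C □_D C, with the coactions inherited from C ⊗ C. *)
Definition cotensor : bicomodule C C :=
  @eqz_bicomod k C C (sq_bicomod C) _ cot_l cot_r cot_lstable cot_rstable.

Lemma cotensor_lcoactE (x : cotensor) :
  tmap idfun (@eqz_val _ _ _ cot_l cot_r) (lcoact cotensor x) =
  tassoc (tmap comul idfun (eqz_val x)).
Proof. exact: (@eqz_lcoactE k C C (sq_bicomod C) _ cot_l cot_r cot_lstable). Qed.

Lemma cotensor_rcoactE (x : cotensor) :
  tassoc (tmap (@eqz_val _ _ _ cot_l cot_r) idfun (rcoact cotensor x)) =
  tmap idfun comul (eqz_val x).
Proof.
have := @eqz_rcoactE k C C (sq_bicomod C) _ cot_l cot_r cot_rstable x.
rewrite -[rcoact _ _]/(sq_rcoact C _).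
by move=> xE; rewrite [X in tassoc X]xE /= tassocVK.
Qed.

Definition left_codepth_two : Prop := exists2 N : nat, (0 < N)%N &
  direct_summand (corestrl g cotensor)
    (bicomod_pow (corestrl g (regular_bicomod C)) N).

Definition right_codepth_two : Prop := exists2 N : nat, (0 < N)%N &
  direct_summand (corestrr g cotensor)
    (bicomod_pow (corestrr g (regular_bicomod C)) N).

End Cotensor.

Section CoGalois.
Variables (k : fieldType) (H : hopfAlgType k) (C : modCoalgType H).
Local Notation p := (pbar C).

(* can_gen (c ⊗ h) = c_(1) ⊗ c_(2) h. *)
Definition can_gen : {linear C ⊗ H -> C ⊗ C} :=
  tmap idfun (tlift ract) \o (tassoc \o tmap comul idfun).

Lemma can_genE c h :
  can_gen (c ⊗ₜ h) = tmap idfun (applyr (@ract k H C) h) (comul c).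
Proof.
rewrite /can_gen /= tmapE tassoc_tmulr tmap_comp; apply: tmap_eq => // d /=.
by rewrite tliftE.
Qed.

Lemma can_gen_cot x : cot_l p (can_gen x) = cot_r p (can_gen x).
Proof.
apply: (tensor_ext (f := cot_l p \o can_gen) (g := cot_r p \o can_gen)) => c h.
rewrite -[LHS]/(cot_l p (can_gen (c ⊗ₜ h))).
rewrite -[RHS]/(cot_r p (can_gen (c ⊗ₜ h))).
rewrite can_genE /cot_l /cot_r /= !tmap_comp.
have -> : tmap ((tmap idfun p \o comul) \o idfun)
    (idfun \o applyr ract h) (comul c) =
    tmap (tmap idfun p) (applyr (@ract k H C) h) (tmap comul idfun (comul c)).
  by rewrite tmap_comp; apply: tmap_eq.
rewrite tassoc_nat comulA tmap_comp; apply: tmap_eq => // d /=.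
rewrite comul_ract.
have pE (z : C ⊗ C) (y : H ⊗ H) : tmap p idfun (tbimap ract ract z y) =
    tmap p (applyr (@ract k H C) (tunitl (tmap counit idfun y))) z.
  elim/tensor_ind: z => [|c1 c2|z z' IHz IHz'].
  - by rewrite linear0l !linear0.
  - rewrite tmapE /=; elim/tensor_ind: y => [|h1 h2|y y' IHy IHy'].
    + by rewrite linear0r !linear0 ?linear0r.
    + rewrite tbimapE !tmapE tunitlE /= pi_ract.
      by rewrite linearZl_LR !linearZr_LR.
    + by rewrite linearDr !linearD /= IHy IHy' ?linearDr.
  - by rewrite linearDl !linearD /= IHz IHz'.
by rewrite pE counitl.
Qed.

Definition can (x : C ⊗ H) : cotensor p :=
  @Equalizer k (C ⊗ C) _ (cot_l p) (cot_r p) (can_gen x)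
    (introT eqP (can_gen_cot x)).

Definition coGalois : Prop := bijective can.

End CoGalois.
Arguments coGalois {k H} C.

(* Main.v *)
Require Import Defs.
From HB Require Import structures.
From mathcomp Require Import all_boot all_algebra all_field.

Set Implicit Arguments.
Unset Strict Implicit.
Unset Printing Implicit Defensive.
Import GRing.Theory.
Local Open Scope ring_scope.

(** Write Delta h = h1 ⊗ h2 for comultiplication, S for the antipode, and
    e_1, ..., e_N for a basis of H with dual basis e^1, ..., e^N.

    The value can (c ⊗ h) = c1 ⊗ c2 h involves h only in its right leg, so can
    is left C-colinear in c.  Since p (c h) = (counit h) p c, the right coaction
    corestricted to Cbar = C / CH^+ does not see h either.  Hence, for each fixed
    h, the map c |-> can (c ⊗ h) is a map of C-Cbar-bicomodules from C
    ([can_at_bicolinear]).  As h runs through the basis, these maps are the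
    components of an isomorphism from C^N to C □ C, because can is bijective; so
    p is right codepth two.

    On the other side one uses the flipped map c ⊗ h |-> c1 h ⊗ c2, which for
    fixed h is a map of Cbar-C-bicomodules for the mirror reason
    ([can_flip_at_bicolinear]).  It is the composite of can with
    c ⊗ h |-> c h1 ⊗ S h2 ([val_can_flip]).  The map c ⊗ h |-> c h1 ⊗ h2 is
    always invertible, with inverse c ⊗ h |-> c (S h1) ⊗ h2, so the flipped map
    is bijective as soon as S is.

    What remains is that the antipode of a finite dimensional Hopf algebra is
    bijective ([antipode_bij]).  By dimension, injectivity suffices.  It follows
    from the existence of a nonzero left integral L, that is, of L with
    a L = (counit a) L for all a.  Such an L satisfies
    L1 ⊗ b L2 = (S b) L1 ⊗ L2.  If S a = 0, then S (a y) = (S y) (S a) = 0, so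
    L1 ⊗ a y L2 = 0 for all y; hence f(L) a = f(L1) a (S L2) L3 = 0 for every
    functional f.

    A nonzero left integral is produced by traces.  For z in H and a functional f
    let X_{f,z} be the operator y |-> f(y1) S^2(y2) z.  The element L_z with
    f(L_z) = tr X_{f,z} for all f is a left integral: replacing f by f(a -)
    turns X_{f,z} into the sum of the y |-> (S a2) X_{f,z}(a1 y), and cyclicity
    of the trace moves S a2 next to a1, where a1 (S a2) = counit a.  Not all L_z
    vanish, because the sum of the numbers e^k (S L_{e_k}) is the trace of
    y |-> S^2(y2) (S y1) = S (y1 (S y2)) = (counit y) 1, which is 1. *)

(** * Linear maps out of tensor products *)

Definition trilinear_map (k : fieldType) (U V W X : lmodType k)
    (F : U -> V -> W -> X) : Prop :=
  [/\ forall v w, linear (fun u => F u v w),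
      forall u w, linear (fun v => F u v w) &
      forall u v, linear (F u v)].

Section Linear.
Variables (k : fieldType) (U V W : lmodType k).

Lemma linear_exists (f : U -> V) : linear f -> exists g : {linear U -> V}, g =1 f.
Proof.
move=> fL; pose g : {linear U -> V} :=
  HB.pack f (GRing.isLinear.Build _ _ _ _ f fL).
by exists g.
Qed.

Lemma linear_lincomb (f : U -> V) (I : Type) (r : seq I) (P : pred I) a u :
  linear f ->
  f (\sum_(i <- r | P i) a i *: u i) = \sum_(i <- r | P i) a i *: f (u i).
Proof.
move=> /linear_exists[g gE]; rewrite -gE linear_sum.
by apply: eq_bigr => i _; rewrite linearZ -gE.
Qed.

Lemma linear_sum_fun (I : Type) (r : seq I) (f : I -> U -> V) :
  (forall i, linear (f i)) -> linear (fun u => \sum_(i <- r) f i u).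
Proof.
move=> fL a u v; rewrite scaler_sumr -big_split; apply: eq_bigr => i _.
exact: fL.
Qed.

Lemma tlift_exists (F : U -> V -> W) : bilinear_map F ->
  exists g : {linear U ⊗ V -> W}, forall u v, g (u ⊗ₜ v) = F u v.
Proof.
move=> FB; pose f : {bilinear U -> V -> W} :=
  HB.pack F (bilinear_isBilinear.Build k U V W _ _ F FB).
by exists (tlift f) => u v; exact: tliftE.
Qed.

End Linear.

Section TrilinearLift.
Variables (k : fieldType) (U V W X : lmodType k).

Lemma tlift3_exists (F : U -> V -> W -> X) : trilinear_map F ->
  exists g : {linear U ⊗ (V ⊗ W) -> X},
    forall u v w, g (u ⊗ₜ (v ⊗ₜ w)) = F u v w.
Proof.
case=> F1 F2 F3.
have FB u : bilinear_map (F u) by split=> [w|v]; [exact: F2|exact: F3].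
pose f u : {bilinear V -> W -> X} :=
  HB.pack (F u) (bilinear_isBilinear.Build k V W X _ _ (F u) (FB u)).
have [|g gE] := @tlift_exists k U (V ⊗ W) X (fun u => tlift (f u)).
  split=> [t|u]; last exact: linearP.
  move=> a u u'; elim/tensor_ind: t => [|v w|x y IHx IHy].
  - by rewrite /= !linear0 addr0.
  - by rewrite /= !(@tliftE _ _ _ _ (f _)); exact: F1.
  - by rewrite /= !linearD /= IHx IHy addrACA.
by exists g => u v w; rewrite gE (@tliftE _ _ _ _ (f u)).
Qed.
End TrilinearLift.

(* Normalizes both sides of a linearity equation to a sum of scaled terms; a
   product of two scalars may still have to be commuted. *)
Ltac lin := intros; try move=> ? ? ?;
  rewrite /= ?(linearP, linearPl, linearPr, mulrDl, mulrDr, scalerDl, scalerDr,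
    =^~ scalerAl, =^~ scalerAr, scalerA) //=; try by rewrite mulrC.

(** * Sums over Sweedler components *)

(* The pairs (c1, c2) of some decomposition of Delta c. *)
Local Notation sw c := (trepr (comul c)).

Section Sweedler.
Variables (k : fieldType) (C : coalgType k).

Lemma comulE (c : C) : comul c = \sum_(p <- sw c) p.1 ⊗ₜ p.2.
Proof. by rewrite -{1}(treprK (comul c)) tpiE. Qed.

Section Value.
Variable (V : lmodType k).

Lemma sweedlerE (f : {linear C ⊗ C -> V}) c :
  f (comul c) = \sum_(p <- sw c) f (p.1 ⊗ₜ p.2).
Proof. by rewrite {1}comulE linear_sum. Qed.

(** All identities about sums indexed by the components of a comultiplication
    reduce to this one: such a sum depends only on the tensor, although the
    list of components is chosen arbitrarily. *)
Lemma sweedler_factor (F : C -> C -> V) : bilinear_map F ->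
  exists2 f : {linear C ⊗ C -> V}, (forall u v, f (u ⊗ₜ v) = F u v) &
    forall c, \sum_(p <- sw c) F p.1 p.2 = f (comul c).
Proof.
move=> /tlift_exists[f fE]; exists f => // c.
by rewrite sweedlerE; apply: eq_bigr => p _; rewrite fE.
Qed.

Lemma sweedler_linear (F : C -> C -> V) : bilinear_map F ->
  linear (fun c => \sum_(p <- sw c) F p.1 p.2).
Proof. by move=> /sweedler_factor[f _ fE] a c d; rewrite !fE !linearP. Qed.

Lemma sweedlerZ (F : C -> C -> V) a c : bilinear_map F ->
  \sum_(p <- sw (a *: c)) F p.1 p.2 = a *: \sum_(p <- sw c) F p.1 p.2.
Proof. by move=> /sweedler_factor[f _ fE]; rewrite !fE !linearZ. Qed.

(** Coassociativity, in the form used throughout: F (c1, c2, c3) may be read off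
    by splitting either leg of Delta c. *)
Lemma sweedlerA (F : C -> C -> C -> V) c : trilinear_map F ->
  \sum_(p <- sw c) \sum_(q <- sw p.1) F q.1 q.2 p.2 =
  \sum_(p <- sw c) \sum_(q <- sw p.2) F p.1 q.1 q.2.
Proof.
move=> /tlift3_exists[f fE].
transitivity (f (tmap idfun comul (comul c))).
  rewrite -comulA; have := sweedlerE (f \o (tassoc \o tmap comul idfun)) c.
  move=> /= ->; apply: eq_bigr => p _.
  rewrite tmapE /=.
  have := sweedlerE (f \o (tassoc \o applyr (@tmul k _ C) p.2)) p.1.
  by move=> /= ->; apply: eq_bigr => q _ /=; rewrite tassocE fE.
have := sweedlerE (f \o tmap idfun comul) c; move=> /= ->; apply: eq_bigr => p _.
rewrite tmapE /=; have := sweedlerE (f \o @tmul k C _ p.1) p.2.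
by move=> /= ->; apply: eq_bigr => q _ /=; rewrite fE.
Qed.
End Value.

Lemma sweedler_tmap (U V : lmodType k) (f : {linear C -> U})
    (g : {linear C -> V}) c :
  tmap f g (comul c) = \sum_(q <- sw c) f q.1 ⊗ₜ g q.2.
Proof.
by rewrite (sweedlerE (tmap f g)); apply: eq_bigr => q _; exact: tmapE.
Qed.

Lemma sweedler_counitl (c : C) : \sum_(p <- sw c) (counit p.1 : k) *: p.2 = c.
Proof.
rewrite -[RHS]counitl; have := sweedlerE (tunitl \o tmap counit idfun) c.
by move=> /= ->; apply: eq_bigr => p _; rewrite tmapE tunitlE.
Qed.

Lemma sweedler_counitr (c : C) : \sum_(p <- sw c) (counit p.2 : k) *: p.1 = c.
Proof.
rewrite -[RHS]counitr; have := sweedlerE (tunitr \o tmap idfun counit) c.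
by move=> /= ->; apply: eq_bigr => p _; rewrite tmapE tunitrE.
Qed.
End Sweedler.

(** * The antipode is an antihomomorphism *)

Section Hopf.
Variables (k : fieldType) (H : hopfAlgType k).
Implicit Types g h : H.
Local Notation S := (antipode : {linear H -> H}).

Lemma sweedlerM (V : lmodType k) (F : H -> H -> V) g h : bilinear_map F ->
  \sum_(r <- sw (g * h)) F r.1 r.2 =
  \sum_(p <- sw g) \sum_(q <- sw h) F (p.1 * q.1) (p.2 * q.2).
Proof.
move=> /sweedler_factor[f fE ->]; rewrite comulM {1}[comul g]comulE.
rewrite linear_sumlz (linear_sum f).
apply: eq_bigr => p _; rewrite {1}[comul h]comulE linear_sumr (linear_sum f) /=.
by apply: eq_bigr => q _; rewrite tbimapE fE.
Qed.

Lemma antipode_suml h : \sum_(p <- sw h) S p.1 * p.2 = (counit h : k) *: 1.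
Proof.
rewrite -antipodel; have := sweedlerE (tlift (@amul k H) \o tmap S idfun) h.
by move=> /= ->; apply: eq_bigr => p _; rewrite tmapE tliftE.
Qed.

Lemma antipode_sumr h : \sum_(p <- sw h) p.1 * S p.2 = (counit h : k) *: 1.
Proof.
rewrite -antipoder; have := sweedlerE (tlift (@amul k H) \o tmap idfun S) h.
by move=> /= ->; apply: eq_bigr => p _; rewrite tmapE tliftE.
Qed.

Lemma antipode1 : S 1 = 1.
Proof.
have := antipoder (1 : H).
by rewrite comul1 tmapE tliftE /= /amul mul1r counit1 scale1r.
Qed.

(** Both sides are the convolution inverse of the multiplication of H: the sum
    of all S (g1 h1) g2 h2 (S h3) (S g3) reduces to either of them. *)
Lemma antipodeM g h : S (g * h) = S h * S g.
Proof.
pose X := \sum_(p <- sw g) \sum_(p' <- sw p.2) \sum_(q <- sw h) \sum_(q' <- sw q.2)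
  S (p.1 * q.1) * (p'.1 * (q'.1 * S q'.2) * S p'.2).
transitivity X.
  rewrite -[in LHS](sweedler_counitr g) -[in LHS](sweedler_counitr h).
  rewrite mulr_suml linear_sum; apply: eq_bigr => p _ /=.
  rewrite exchange_big mulr_sumr linear_sum; apply: eq_bigr => q _ /=.
  under eq_bigr => p' _.
    rewrite -mulr_sumr -mulr_suml -mulr_sumr antipode_sumr.
    rewrite mulr_algr -scalerAl -scalerAr.
    over.
  rewrite -scaler_sumr -mulr_sumr antipode_sumr mulr_algr.
  by rewrite -scalerAl -scalerAr !scalerA linearZ /= mulrC.
(* Regroup so that S (g1 h1) meets g2 h2: coassociativity in g, then in h. *)
pose F x y z :=
  \sum_(q <- sw h) \sum_(q' <- sw q.2) S (x * q.1) * (y * (q'.1 * S q'.2) * S z).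
rewrite /X -(@sweedlerA _ _ _ F); last first.
  by split; intros; do 2!apply: linear_sum_fun => ?; lin.
rewrite /F {F}.
have E (p p' : H * H) : \sum_(q <- sw h) \sum_(q' <- sw q.2)
    S (p'.1 * q.1) * (p'.2 * (q'.1 * S q'.2) * S p.2) =
  \sum_(q <- sw h) \sum_(q' <- sw q.1)
    (S (p'.1 * q'.1) * (p'.2 * q'.2)) * (S q.2 * S p.2).
  pose G x y z := S (p'.1 * x) * (p'.2 * (y * S z) * S p.2).
  rewrite -(@sweedlerA _ _ _ G); last by rewrite /G; split; lin.
  apply: eq_bigr => q _; apply: eq_bigr => q' _.
  by rewrite /G !mulrA.
under eq_bigr => p _.
  under eq_bigr => p' _ do rewrite E.
  rewrite exchange_big /=.
  under eq_bigr => q _.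
    under eq_bigr => p' _ do rewrite -mulr_suml.
    rewrite -mulr_suml -(@sweedlerM _ (fun x y => S x * y)); last by split; lin.
    rewrite antipode_suml counitM mulr_algl.
    over.
  over.
rewrite -[in RHS](sweedler_counitl g) -[in RHS](sweedler_counitl h) /=.
rewrite !linear_sum mulr_sumr.
apply: eq_bigr => p _; rewrite mulr_suml; apply: eq_bigr => q _.
by rewrite !linearZ /= -scalerAl -scalerAr !scalerA mulrC.
Qed.
End Hopf.

(** * Traces on finite dimensional spaces *)

Section Trace.
Variables (k : fieldType) (V : vectType k).
Local Notation e := (vbasis {:V}).

Lemma vbasis_sum (v : V) : \sum_i coord e i v *: e`_i = v.
Proof. by rewrite -coord_vbasis ?memvf. Qed.

Definition trace (X : V -> V) : k := \sum_i coord e i (X e`_i).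

Lemma traceC (X Y : V -> V) : linear X -> linear Y ->
  trace (fun v => X (Y v)) = trace (fun v => Y (X v)).
Proof.
move=> XL YL; rewrite /trace.
have E (f g : V -> V) i : linear f -> coord e i (f (g e`_i)) =
    \sum_j coord e j (g e`_i) * coord e i (f e`_j).
  move=> fL; rewrite -{1}(vbasis_sum (g e`_i)) linear_lincomb // linear_sum.
  by apply: eq_bigr => j _; rewrite linearZ.
under eq_bigr => i _ do rewrite /= (E X Y) //.
rewrite exchange_big; apply: eq_bigr => j _; rewrite /= (E Y X) //.
by apply: eq_bigr => i _; rewrite mulrC.
Qed.

Lemma trace_sum (I : Type) (r : seq I) (X : I -> V -> V) :
  trace (fun v => \sum_(i <- r) X i v) = \sum_(i <- r) trace (X i).
Proof.
by rewrite /trace exchange_big; apply: eq_bigr => i _; rewrite linear_sum.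
Qed.

Lemma traceZ a (X : V -> V) : trace (fun v => a *: X v) = a * trace X.
Proof. by rewrite /trace mulr_sumr; apply: eq_bigr => i _; rewrite linearZ. Qed.

Lemma trace_rank1 (f : {linear V -> k^o}) (v : V) :
  trace (fun w => (f w : k) *: v) = f v.
Proof.
rewrite -{2}(vbasis_sum v) linear_sum; apply: eq_bigr => i _.
by rewrite !linearZ /= mulrC.
Qed.

End Trace.

(** * Left integrals and bijectivity of the antipode *)

Section Antipode.
Variables (k : fieldType) (H : finHopfAlgType k).
Implicit Types a b g h x y z : H.
Local Notation S := (antipode : {linear H -> H}).
Local Notation e := (vbasis {:H}).

Definition left_integral (L : H) : Prop :=
  forall a, a * L = (counit a : k) *: L.

(** The operator X_{f,z} of the introduction. *)
Definition integral_op (z : H) (f : H -> k) (y : H) : H :=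
  \sum_(p <- sw y) f p.1 *: (S (S p.2) * z).

(** The element L_z of the introduction, given by its coordinates; the defining
    property is [trace_integralE]. *)
Definition trace_integral (z : H) : H :=
  \sum_i trace (integral_op z (coord e i)) *: e`_i.

Lemma integral_op_linear z (f : {linear H -> k^o}) : linear (integral_op z f).
Proof.
apply: (@sweedler_linear _ _ _ (fun u v => (f u : k) *: (S (S v) * z))).
by split; lin.
Qed.

Lemma trace_integralE (f : {linear H -> k^o}) z :
  f (trace_integral z) = trace (integral_op z f).
Proof.
rewrite /trace_integral linear_sum.
transitivity (\sum_(i < \dim {:H})
    trace (fun y => (f e`_i : k) *: integral_op z (coord e i) y)).
  by apply: eq_bigr => i _; rewrite traceZ linearZ mulrC.
rewrite -trace_sum; apply: eq_bigr => i _; congr (coord e i _).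
under eq_bigr => j _ do rewrite /integral_op scaler_sumr.
rewrite exchange_big; apply: eq_bigr => p _.
rewrite -[in RHS](vbasis_sum p.1) linear_sum scaler_suml.
by apply: eq_bigr => j _; rewrite [in RHS]linearZ /= scalerA mulrC.
Qed.

(** The first two components a1 and a2 of a are absorbed in comul (a1 y); the
    third cancels S^2 a2, since (S a3) (S^2 a2) = S ((S a2) a3). *)
Lemma integral_op_mull z a (f : {linear H -> k^o}) y :
  integral_op z (fun x => f (a * x)) y =
  \sum_(p <- sw a) S p.2 * integral_op z f (p.1 * y).
Proof.
under eq_bigr => p _.
  rewrite /integral_op.
  rewrite (@sweedlerM _ _ _ (fun u v => (f u : k) *: (S (S v) * z))); last first.
    by split; lin.
  rewrite mulr_sumr.
  over.
pose G (u v w : H) : H :=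
  \sum_(q <- sw y) (f (u * q.1) : k) *: (S w * S (S (v * q.2)) * z).
transitivity (\sum_(p <- sw a) \sum_(r <- sw p.1) G r.1 r.2 p.2); last first.
  apply: eq_bigr => p _; apply: eq_bigr => r _; rewrite /G mulr_sumr.
  by apply: eq_bigr => q _; rewrite -scalerAr mulrA.
rewrite sweedlerA; last by split; intros; apply: linear_sum_fun => ?; lin.
rewrite /integral_op -[in LHS](sweedler_counitr a).
under eq_bigr => q _.
  rewrite mulr_suml linear_sum scaler_suml.
  over.
rewrite exchange_big; apply: eq_bigr => p _; rewrite /G exchange_big.
apply: eq_bigr => q _.
under eq_bigr => r _.
  rewrite [S (r.1 * _)]antipodeM antipodeM [S r.2 * _]mulrA -antipodeM -mulrA.
  over.
rewrite -scaler_sumr -mulr_suml -linear_sum antipode_suml linearZ /= antipode1.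
by rewrite mulr_algl scalerA -scalerAl linearZ /= mulrC.
Qed.

(** By [integral_op_mull] and cyclicity of the trace, f (a L_z) is the trace
    of y |-> a1 (S a2) X_{f,z}(y). *)
Lemma trace_integral_left z : left_integral (trace_integral z).
Proof.
move=> a.
have coordE i : coord e i (a * trace_integral z) =
    (counit a : k) * coord e i (trace_integral z).
  pose f : {linear H -> k^o} := coord e i.
  rewrite -[RHS]/((counit a : k) * f (trace_integral z)) trace_integralE.
  have gL : linear (fun x => f (a * x)) by lin.
  have [g gE] := linear_exists gL.
  rewrite -[LHS]/(f (a * trace_integral z)) -gE trace_integralE.
  have -> : trace (integral_op z g) =
      trace (fun y => \sum_(p <- sw a) S p.2 * integral_op z f (p.1 * y)).
    apply: eq_bigr => j _; rewrite -integral_op_mull.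
    by congr (coord e j _); apply: eq_bigr => p _; rewrite gE.
  have XL b : linear (fun y => b * integral_op z f y).
    by move=> c u v; rewrite (integral_op_linear z f); lin.
  have YL b : linear (fun y => b * y) by lin.
  rewrite trace_sum.
  under eq_bigr => p _ do rewrite (traceC (XL (S p.2)) (YL p.1)).
  rewrite -trace_sum -traceZ; apply: eq_bigr => j _; congr (coord e j _).
  under eq_bigr => p _ do rewrite mulrA.
  by rewrite -mulr_suml antipode_sumr -scalerAl mul1r.
rewrite -[LHS]vbasis_sum -[RHS]vbasis_sum; apply: eq_bigr => i _.
by rewrite coordE linearZ.
Qed.

(** The trace integrals cannot all vanish, because S^2(y2) (S y1) is (counit y) 1,
    an operator of trace 1. *)
Lemma left_integral_exists : exists2 L : H, left_integral L & L != 0.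
Proof.
have sum1 : \sum_i coord e i (S (trace_integral e`_i)) = 1.
  transitivity (trace (fun y : H => (counit y : k) *: (1 : H))); last first.
    by rewrite trace_rank1 counit1.
  transitivity (\sum_(i < \dim {:H})
      trace (integral_op e`_i (fun x => coord e i (S x)))).
    by apply: eq_bigr => i _; rewrite -(trace_integralE (coord e i \o S)).
  rewrite -trace_sum; apply: eq_bigr => j _; congr (coord e j _).
  rewrite exchange_big.
  under eq_bigr => p _.
    under eq_bigr => i _ do rewrite scalerAr.
    rewrite -mulr_sumr vbasis_sum -antipodeM.
    over.
  by rewrite -linear_sum antipode_sumr linearZ /= antipode1.
have [/existsP[i Li]|L0] :=
  boolP [exists i : 'I_(\dim {:H}), trace_integral e`_i != 0].
  by exists (trace_integral e`_i) => //; exact: trace_integral_left.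
have := oner_neq0 k; rewrite -sum1 big1 ?eqxx // => i _.
by move: L0; rewrite negb_exists => /forallP/(_ i)/negPn/eqP ->; rewrite !linear0.
Qed.

(** Insert (S b1) b2 in front of L1; then b2 L1 ⊗ b3 L2 is the comultiplication
    of b2 L = (counit b2) L. *)
Lemma left_integral_antipode (L : H) (g : {linear H -> k^o}) b : left_integral L ->
  \sum_(p <- sw L) (g p.1 : k) *: (b * p.2) =
  \sum_(p <- sw L) (g (S b * p.1) : k) *: p.2.
Proof.
move=> LI.
pose F x y z : H := \sum_(p <- sw L) (g (S x * y * p.1) : k) *: (z * p.2).
have FT : trilinear_map F by split; intros; apply: linear_sum_fun => ?; lin.
transitivity (\sum_(q <- sw b) \sum_(r <- sw q.1) F r.1 r.2 q.2).
  rewrite /F; under [RHS]eq_bigr => q _.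
    rewrite exchange_big /=.
    under eq_bigr => p _.
      rewrite -scaler_suml -(linear_sum g) -mulr_suml antipode_suml.
      rewrite mulr_algl linearZ /= -[X in X *: _]/((counit q.1 : k) * g p.1).
      rewrite mulrC -scalerA scalerAl.
      over.
    over.
  rewrite exchange_big; apply: eq_bigr => p _.
  by rewrite -scaler_sumr -mulr_suml sweedler_counitl.
rewrite sweedlerA //.
have E (q : H * H) : \sum_(r <- sw q.2) F q.1 r.1 r.2 =
    \sum_(p <- sw L) (g (S ((counit q.2 : k) *: q.1) * p.1) : k) *: p.2.
  pose K (u v : H) : H := (g (S q.1 * u) : k) *: v.
  have KB : bilinear_map K by rewrite /K; split; lin.
  transitivity (\sum_(r <- sw (q.2 * L)) K r.1 r.2).
    rewrite sweedlerM //.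
    by apply: eq_bigr => r _; apply: eq_bigr => p _; rewrite /K mulrA.
  rewrite LI sweedlerZ // scaler_sumr; apply: eq_bigr => p _.
  by rewrite [S (_ *: _)]linearZ /= -scalerAl [g (_ *: _)]linearZ scalerA.
under eq_bigr => q _ do rewrite E.
rewrite exchange_big; apply: eq_bigr => p _.
by rewrite -scaler_suml -(linear_sum g) -mulr_suml -linear_sum sweedler_counitr.
Qed.

(** Choose f with f(L) nonzero.  Then f(L) a = f(L1) a (S L2) L3, and expanding
    S L2 in a basis leaves terms g(L1) (a e_j) L2.  By [left_integral_antipode]
    they involve S (a e_j) = (S e_j) (S a) = 0. *)
Lemma antipode_eq0 a : S a = 0 -> a = 0.
Proof.
move=> Sa; have [L LI Ln0] := left_integral_exists.
have [i Li] : exists i, coord e i L != 0.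
  apply/existsP; apply: contraNT Ln0; rewrite negb_exists => /forallP L0.
  rewrite -(vbasis_sum L) big1 // => i _.
  by have := L0 i; rewrite negbK => /eqP ->; rewrite scale0r.
apply: (scalerI Li); rewrite scaler0.
pose f : {linear H -> k^o} := coord e i.
pose F (x y z : H) : H := (f x : k) *: (a * (S y * z)).
have FT : trilinear_map F by rewrite /F; split; lin.
transitivity (\sum_(p <- sw L) \sum_(q <- sw p.2) F p.1 q.1 q.2).
  rewrite -[in LHS](sweedler_counitr L) linear_sum scaler_suml.
  apply: eq_bigr => p _.
  rewrite /F -scaler_sumr -mulr_sumr antipode_suml mulr_algr linearZ /=.
  by rewrite scalerA mulrC.
rewrite -sweedlerA //.
transitivity (\sum_(j < \dim {:H}) \sum_(p <- sw L)
    (\sum_(q <- sw p.1) (f q.1 : k) * coord e j (S q.2)) *: (a * e`_j * p.2)).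
  rewrite exchange_big; apply: eq_bigr => p _.
  under [RHS]eq_bigr => j _ do rewrite scaler_suml.
  rewrite exchange_big; apply: eq_bigr => q _.
  rewrite /F -[in LHS](vbasis_sum (S q.2)) mulr_suml mulr_sumr scaler_sumr.
  apply: eq_bigr => j _.
  by rewrite -scalerAl -scalerAr scalerA mulrA.
apply: big1 => j _.
have gL : linear (fun x =>
    \sum_(q <- sw x) (((f q.1 : k) * coord e j (S q.2) : k) : k^o)).
  apply: (@sweedler_linear _ _ _
    (fun u v => ((f u : k) * coord e j (S v) : k) : k^o)).
  by split; lin; rewrite mulrCA mulrA.
have [g gE] := linear_exists gL.
under eq_bigr => p _ do rewrite -(gE p.1).
rewrite (left_integral_antipode g) // antipodeM Sa mulr0.
by rewrite big1 // => p _; rewrite mul0r linear0 scale0r.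
Qed.

Lemma antipode_bij : bijective S.
Proof.
have lS : lker (linfun S) == 0%VS.
  by apply/lker0P => u v; rewrite !lfunE /= => uv; apply/eqP; rewrite -subr_eq0;
     apply/eqP/antipode_eq0; rewrite linearB /= uv subrr.
exists (linfun S)^-1%VF => x; first by rewrite -{1}(lfunE S) lker0_lfunK.
by rewrite -(lfunE S) lker0_lfunVK.
Qed.
End Antipode.

(** * Bicomodules isomorphic to a power *)

Section SummandOfMaps.
Variables (k : fieldType) (D E : coalgType k) (M R : bicomodule D E) (n : nat).
Variable j : 'I_n -> {linear R -> M}.
Hypothesis j_bicolinear : forall i, bicolinear (j i).
Hypothesis j_bij : bijective (fun x : {ffun 'I_n -> R} => \sum_i j i (x i)).

Lemma pow_lcoact_in i (m : R) :
  pow_lcoact (pow_in i m : {ffun 'I_n -> R}) = tmap idfun (pow_in i) (lcoact R m).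
Proof.
rewrite /pow_lcoact (bigD1 i) //= ffunE eqxx big1 ?addr0 // => l li.
by rewrite ffunE (negPf li) !linear0.
Qed.

Lemma pow_rcoact_in i (m : R) :
  pow_rcoact (pow_in i m : {ffun 'I_n -> R}) = tmap (pow_in i) idfun (rcoact R m).
Proof.
rewrite /pow_rcoact (bigD1 i) //= ffunE eqxx big1 ?addr0 // => l li.
by rewrite ffunE (negPf li) !linear0.
Qed.

(** The sum of the j i is an isomorphism from the power to M, so the complement
    is zero; the empty power serves as the zero bicomodule. *)
Lemma direct_summand_pow : direct_summand M (bicomod_pow R n).
Proof.
pose X := bicomod_pow R n.
have [F FE] : exists F : {linear X -> M}, forall x, F x = \sum_i j i (x i).
  have FL : linear (fun x : X => \sum_i j i (x i)).
    move=> a x y; rewrite scaler_sumr -big_split; apply: eq_bigr => i _.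
    by rewrite !ffunE linearP.
  by have [F FE] := linear_exists FL; exists F.
have F_in i m : F (pow_in i m) = j i m.
  rewrite FE (bigD1 i) //= ffunE eqxx big1 ?addr0 // => l li.
  by rewrite ffunE (negPf li) linear0.
have Fl x : lcoact M (F x) = tmap idfun F (lcoact X x).
  apply: (pow_ext (f := lcoact M \o F) (g := tmap idfun F \o lcoact X)) => i m /=.
  rewrite F_in (j_bicolinear i).1 pow_lcoact_in tmap_comp.
  by apply: tmap_eq => // r /=; rewrite F_in.
have Fr x : rcoact M (F x) = tmap F idfun (rcoact X x).
  apply: (pow_ext (f := rcoact M \o F) (g := tmap F idfun \o rcoact X)) => i m /=.
  rewrite F_in (j_bicolinear i).2 pow_rcoact_in tmap_comp.
  by apply: tmap_eq => // r /=; rewrite F_in.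
have [G [FK GK]] : exists G : {linear M -> X}, cancel F G /\ cancel G F.
  have [G FK GK] : bijective F by exact: eq_bij j_bij _ (fsym FE).
  have [G' GE] := linear_exists (can2_linear FK GK : linear G).
  by exists G'; split=> x; rewrite GE.
pose Z := bicomod_pow R 0.
have Z0 (z : Z) : z = 0 by apply/ffunP => -[].
pose f : {linear (M * Z)%type -> X} := G \o fst.
exists Z, f; split; last first.
  exists (fun x => (F x, 0)) => [[m z]|x] /=; last exact: FK.
  by rewrite (Z0 z) -[RHS]/(m, 0) -{2}(GK m).
split=> x.
  apply: (dsum_ext (f := lcoact X \o f)
    (g := tmap idfun f \o lcoact (dsum M Z))) => [m|z] /=; last first.
    by rewrite (Z0 z) !linear0.
  rewrite dsum_lcoact_inl tmap_comp -{2}(GK m) Fl tmap_comp.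
  by rewrite -[LHS]tmap_id; apply: tmap_eq => // y /=; rewrite -{1}[y]FK.
apply: (dsum_ext (f := rcoact X \o f)
  (g := tmap f idfun \o rcoact (dsum M Z))) => [m|z] /=; last first.
  by rewrite (Z0 z) !linear0.
rewrite dsum_rcoact_inl tmap_comp -{2}(GK m) Fr tmap_comp.
by rewrite -[LHS]tmap_id; apply: tmap_eq => // y /=; rewrite -{1}[y]FK.
Qed.
End SummandOfMaps.

Section TensorBasis.
Variables (k : fieldType) (U : lmodType k) (V : vectType k).
Local Notation e := (vbasis {:V}).

Lemma tensor_vbasis_bij :
  bijective (fun x : {ffun 'I_(\dim {:V}) -> U} => \sum_i x i ⊗ₜ e`_i).
Proof.
pose c i : {linear V -> k^o} := coord e i.
exists (fun t => [ffun i => tunitr (tmap (@idfun U) (c i) t)]) => [x|t].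
  apply/ffunP => i; rewrite ffunE.
  have -> : tunitr (tmap idfun (c i) (\sum_(j < \dim {:V}) x j ⊗ₜ e`_j)) =
      \sum_(j < \dim {:V}) (c i e`_j : k) *: x j.
    rewrite -[LHS]/((tunitr \o tmap idfun (c i)) _).
    rewrite (linear_sum (tunitr \o tmap idfun (c i))).
    by apply: eq_bigr => j _; rewrite /= tmapE tunitrE.
  rewrite (bigD1 i) //= big1 ?addr0 => [|j ji].
    by rewrite /c coord_free ?(basis_free (vbasisP _)) // eqxx scale1r.
  by rewrite /c coord_free ?(basis_free (vbasisP _)) // (negPf ji) scale0r.
elim/tensor_ind: t => [|u v|t t' IHt IHt'].
- by rewrite big1 // => i _; rewrite ffunE !linear0 linear0l.
- rewrite -[in RHS](vbasis_sum v) linear_sumr; apply: eq_bigr => i _.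
  by rewrite ffunE tmapE tunitrE linearZl_LR linearZr_LR.
- rewrite -{2}IHt -{2}IHt' -big_split; apply: eq_bigr => i _.
  by rewrite !ffunE !linearD linearDl.
Qed.
End TensorBasis.

(** * The canonical map and its flip *)

Section Canonical.
Variables (k : fieldType) (H : finHopfAlgType k) (C : modCoalgType H).
Local Notation S := (antipode : {linear H -> H}).
Local Notation e := (vbasis {:H}).
Local Notation p := (pbar C).
Local Notation CC := (cotensor p).
Local Notation val := (@eqz_val _ _ _ (cot_l p) (cot_r p)).

Lemma sweedler_ract (V : lmodType k) (F : C -> C -> V) (c : C) (h : H) :
  bilinear_map F ->
  \sum_(r <- sw (ract c h)) F r.1 r.2 =
  \sum_(q <- sw c) \sum_(r <- sw h) F (ract q.1 r.1) (ract q.2 r.2).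
Proof.
move=> /sweedler_factor[f fE ->]; rewrite comul_ract {1}[comul c]comulE.
rewrite linear_sumlz (linear_sum f).
apply: eq_bigr => q _; rewrite {1}[comul h]comulE linear_sumr (linear_sum f) /=.
by apply: eq_bigr => r _; rewrite tbimapE fE.
Qed.

Lemma pbar_ract c h : p (ract c h) = (counit h : k) *: p c.
Proof. exact: pi_ract. Qed.

Definition can_lin (x : C ⊗ H) : CC := can x.
Lemma can_lin_linear : linear can_lin.
Proof. by move=> a x y; apply: val_inj; rewrite /= !linearP. Qed.
HB.instance Definition _ :=
  GRing.isLinear.Build k (C ⊗ H) CC _ can_lin can_lin_linear.

Lemma val_can_lin c h :
  val (can_lin (c ⊗ₜ h)) = \sum_(q <- sw c) q.1 ⊗ₜ ract q.2 h.
Proof. by rewrite -[LHS]/(can_gen C (c ⊗ₜ h)) can_genE sweedler_tmap. Qed.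

(** The map c ⊗ h |-> c (A h1) ⊗ h2.  For A the identity and A the antipode the
    two maps are mutually inverse. *)
Definition twist (A : {linear H -> H}) : {linear C ⊗ H -> C ⊗ H} :=
  tmap (tlift ract) idfun \o (tassocV \o tmap idfun (tmap A idfun \o comul)).

Lemma twistE A c h :
  twist A (c ⊗ₜ h) = \sum_(r <- sw h) ract c (A r.1) ⊗ₜ r.2.
Proof.
rewrite /twist /= tmapE /= tassocV_tmull !tmap_comp sweedler_tmap.
by apply: eq_bigr => r _ /=; rewrite tliftE.
Qed.

Lemma twistK : cancel (twist idfun) (twist S).
Proof.
move=> t; apply: (tensor_ext (f := twist S \o twist idfun) (g := idfun)) => c h.
rewrite -[LHS]/(twist S (twist idfun (c ⊗ₜ h))) twistE linear_sum.
under eq_bigr => r _ do rewrite twistE.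
pose F x y z : C ⊗ H := ract (ract c x) (S y) ⊗ₜ z.
have FT : trilinear_map F by rewrite /F; split; lin.
transitivity (\sum_(r <- sw h) \sum_(q <- sw r.1) F q.1 q.2 r.2).
  by rewrite (sweedlerA _ FT).
rewrite -[in RHS](sweedler_counitl h) /= linear_sumr.
apply: eq_bigr => r _; rewrite /F -linear_sumlz.
under eq_bigr => q _ do rewrite -ractM.
by rewrite -linear_sumr antipode_sumr linearZr_LR /= ract1 linearZl_LR linearZr_LR.
Qed.

Lemma twistVK : cancel (twist S) (twist idfun).
Proof.
move=> t; apply: (tensor_ext (f := twist idfun \o twist S) (g := idfun)) => c h.
rewrite -[LHS]/(twist idfun (twist S (c ⊗ₜ h))) twistE linear_sum.
under eq_bigr => r _ do rewrite twistE.
pose F x y z : C ⊗ H := ract (ract c (S x)) y ⊗ₜ z.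
have FT : trilinear_map F by rewrite /F; split; lin.
transitivity (\sum_(r <- sw h) \sum_(q <- sw r.1) F q.1 q.2 r.2).
  by rewrite (sweedlerA _ FT).
rewrite -[in RHS](sweedler_counitl h) /= linear_sumr.
apply: eq_bigr => r _; rewrite /F -linear_sumlz.
under eq_bigr => q _ do rewrite -ractM.
by rewrite -linear_sumr antipode_suml linearZr_LR /= ract1 linearZl_LR linearZr_LR.
Qed.

(** Defined as the composite that shows its bijectivity and that its values lie in
    the cotensor product; by [val_can_flip] it is c ⊗ h |-> c1 h ⊗ c2. *)
Definition can_flip : {linear C ⊗ H -> CC} :=
  can_lin \o (tmap idfun S \o twist idfun).

Lemma can_flip_bij : coGalois C -> bijective can_flip.
Proof.
move=> canB; apply: (bij_comp canB); apply: bij_comp; last first.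
  by exists (twist S); [exact: twistK | exact: twistVK].
have [S' SK S'K] := antipode_bij H.
have [T TE] := linear_exists (can2_linear SK S'K : linear S').
exists (tmap idfun T) => t; rewrite /= tmap_comp -[RHS]tmap_id;
  apply: tmap_eq => // h /=.
  by rewrite TE SK.
by rewrite TE S'K.
Qed.

(** Since can (c h1 ⊗ S h2) = c1 h1 ⊗ c2 h2 (S h3), the last two factors cancel. *)
Lemma val_can_flip c h :
  val (can_flip (c ⊗ₜ h)) = \sum_(q <- sw c) ract q.1 h ⊗ₜ q.2.
Proof.
pose G : {linear C ⊗ H -> C ⊗ C} := val \o (can_lin \o tmap idfun S).
have GE d g : G (d ⊗ₜ g) = \sum_(q <- sw d) q.1 ⊗ₜ ract q.2 (S g).
  by rewrite -[LHS]/(val (can_lin (tmap idfun S (d ⊗ₜ g)))) tmapE val_can_lin.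
have -> : can_flip (c ⊗ₜ h) =
    can_lin (tmap idfun S (twist idfun (c ⊗ₜ h))) by [].
rewrite twistE -[LHS]/(G _) linear_sum.
under eq_bigr => r _ do rewrite GE.
under eq_bigr => r _.
  rewrite (@sweedler_ract _ (fun u v => u ⊗ₜ ract v (S r.2))); last by split; lin.
  over.
rewrite exchange_big; apply: eq_bigr => q _ /=.
pose F x y z : C ⊗ C := ract q.1 x ⊗ₜ ract (ract q.2 y) (S z).
have FT : trilinear_map F by rewrite /F; split; lin.
transitivity (\sum_(r <- sw h) \sum_(s <- sw r.1) F s.1 s.2 r.2) => //.
rewrite (sweedlerA _ FT) -[in RHS](sweedler_counitr h) linear_sumr linear_sumlz.
apply: eq_bigr => r _; rewrite /F.
under eq_bigr => s _ do rewrite -ractM.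
rewrite -!linear_sumr antipode_sumr linearZr_LR /= ract1.
by rewrite linearZr_LR linearZr_LR linearZl_LR.
Qed.

(** The coactions on the cotensor product are known only after embedding it in
    C ⊗ C, so colinearity is tested there. *)
Lemma val_lcoact_inj (U : lmodType k) :
  injective (tmap (@idfun U) val : U ⊗ CC -> U ⊗ (C ⊗ C)).
Proof.
apply: (can_inj (g := tmap idfun (eqz_retract (cot_l p) (cot_r p)))) => t.
by rewrite tmap_comp -[RHS]tmap_id; apply: tmap_eq => // x; exact: eqz_retractK.
Qed.

Lemma val_rcoact_inj (U : lmodType k) :
  injective (tmap val (@idfun U) : CC ⊗ U -> (C ⊗ C) ⊗ U).
Proof.
apply: (can_inj (g := tmap (eqz_retract (cot_l p) (cot_r p)) idfun)) => t.
by rewrite tmap_comp -[RHS]tmap_id; apply: tmap_eq => // x; exact: eqz_retractK.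
Qed.

Definition can_at (h : H) : {linear C -> CC} := can_lin \o applyr (@tmul k C H) h.
Definition can_flip_at (h : H) : {linear C -> CC} :=
  can_flip \o applyr (@tmul k C H) h.

Lemma val_can_at h c :
  val (can_at h c) = \sum_(q <- sw c) q.1 ⊗ₜ ract q.2 h.
Proof. exact: val_can_lin. Qed.
Lemma val_can_flip_at h c :
  val (can_flip_at h c) = \sum_(q <- sw c) ract q.1 h ⊗ₜ q.2.
Proof. exact: val_can_flip. Qed.

(** Left colinearity is coassociativity, valid over C itself.  On the right,
    c1 ⊗ c2 h1 ⊗ p (c3 h2) = c1 ⊗ c2 h ⊗ p c3, so colinearity needs the passage
    to the quotient. *)
Lemma can_at_bicolinear h :
  @bicolinear k C (Cbar C) (corestrr p (regular_bicomod C)) (corestrr p CC)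
    (can_at h).
Proof.
split=> c.
  apply: val_lcoact_inj; rewrite cotensor_lcoactE val_can_at.
  rewrite tmap_comp -[lcoact _ c]/(comul c) sweedler_tmap.
  pose F x y z : C ⊗ (C ⊗ C) := x ⊗ₜ (y ⊗ₜ ract z h).
  have FT : trilinear_map F by rewrite /F; split; lin.
  transitivity (\sum_(q <- sw c) \sum_(r <- sw q.1) F r.1 r.2 q.2).
    rewrite -[LHS]/((tassoc \o tmap comul idfun) _) linear_sum.
    apply: eq_bigr => q _.
    by rewrite /= tmapE tassoc_tmulr sweedler_tmap.
  rewrite (sweedlerA _ FT); apply: eq_bigr => q _.
  by rewrite -linear_sumr; congr (_ ⊗ₜ _); exact: esym (val_can_at h q.2).
apply: val_rcoact_inj; apply: (can_inj (@tassocK _ _ _ _)).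
rewrite -[rcoact _ c]/(tmap idfun p (comul c)).
rewrite -[rcoact _ _]/(tmap idfun p (rcoact CC (can_at h c))).
have -> : tassoc (tmap val idfun (tmap idfun p (rcoact CC (can_at h c)))) =
    tmap idfun (tmap idfun p) (tmap idfun comul (val (can_at h c))).
  rewrite -cotensor_rcoactE -tassoc_nat !tmap_comp; congr tassoc.
  by apply: tmap_eq => // x /=; rewrite tmap_id.
rewrite val_can_at !tmap_comp sweedler_tmap.
pose F x y z : C ⊗ (C ⊗ Cbar C) := x ⊗ₜ (ract y h ⊗ₜ p z).
have FT : trilinear_map F by rewrite /F; split; lin.
transitivity (\sum_(q <- sw c) \sum_(r <- sw q.2) F q.1 r.1 r.2).
  rewrite (linear_sum (tmap idfun (tmap idfun p \o comul))).
  apply: eq_bigr => q _; rewrite /= tmapE -linear_sumr /=; congr (_ ⊗ₜ _).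
  rewrite sweedler_tmap (@sweedler_ract _ (fun u v => u ⊗ₜ p v)); last first.
    by split; lin.
  apply: eq_bigr => r _.
  rewrite -[in RHS](sweedler_counitr h) linear_sumr linear_sumlz.
  by apply: eq_bigr => s _ /=; rewrite pbar_ract !linearZr_LR linearZl_LR.
rewrite -(sweedlerA _ FT) (linear_sum tassoc); apply: eq_bigr => q _.
rewrite [X in X ⊗ₜ _](val_can_at h q.1) linear_sumlz (linear_sum tassoc).
by apply: eq_bigr => r _; rewrite /= tassocE.
Qed.

(** Mirror image: p (c1 h1) ⊗ c2 h2 ⊗ c3 = p c1 ⊗ c2 h ⊗ c3. *)
Lemma can_flip_at_bicolinear h :
  @bicolinear k (Cbar C) C (corestrl p (regular_bicomod C)) (corestrl p CC)
    (can_flip_at h).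
Proof.
split=> c.
  apply: val_lcoact_inj.
  rewrite -[lcoact _ c]/(tmap p idfun (comul c)).
  rewrite -[lcoact _ _]/(tmap p idfun (lcoact CC (can_flip_at h c))).
  have -> : tmap idfun val (tmap p idfun (lcoact CC (can_flip_at h c))) =
      tmap p idfun (tassoc (tmap comul idfun (val (can_flip_at h c)))).
    by rewrite -cotensor_lcoactE !tmap_comp; apply: tmap_eq.
  rewrite val_can_flip_at !tmap_comp sweedler_tmap.
  pose F x y z : Cbar C ⊗ (C ⊗ C) := p x ⊗ₜ (ract y h ⊗ₜ z).
  have FT : trilinear_map F by rewrite /F; split; lin.
  transitivity (\sum_(q <- sw c) \sum_(r <- sw q.1) F r.1 r.2 q.2).
    pose G : {linear C ⊗ C -> Cbar C ⊗ (C ⊗ C)} :=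
      tmap p idfun \o (tassoc \o tmap comul idfun).
    rewrite -[LHS]/(G _) linear_sum; apply: eq_bigr => q _.
    rewrite /G /= tmapE tassoc_tmulr tmap_comp sweedler_tmap.
    rewrite (@sweedler_ract _ (fun u v => p u ⊗ₜ (v ⊗ₜ q.2))); last by split; lin.
    apply: eq_bigr => r _; rewrite /F -[in RHS](sweedler_counitl h).
    rewrite linear_sumr linear_sumlz linear_sumr.
    apply: eq_bigr => s _ /=.
    by rewrite pbar_ract linearZl_LR linearZr_LR linearZl_LR linearZr_LR.
  rewrite (sweedlerA _ FT); apply: eq_bigr => q _.
  by rewrite -linear_sumr; congr (_ ⊗ₜ _); exact: esym (val_can_flip_at h q.2).
apply: val_rcoact_inj; apply: (can_inj (@tassocK _ _ _ _)).
rewrite cotensor_rcoactE val_can_flip_at tmap_comp.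
rewrite -[rcoact _ c]/(comul c) sweedler_tmap.
pose F x y z : C ⊗ (C ⊗ C) := ract x h ⊗ₜ (y ⊗ₜ z).
have FT : trilinear_map F by rewrite /F; split; lin.
transitivity (\sum_(q <- sw c) \sum_(r <- sw q.2) F q.1 r.1 r.2).
  rewrite (linear_sum (tmap idfun comul)); apply: eq_bigr => q _.
  by rewrite /= tmapE {1}[comul q.2]comulE linear_sumr.
rewrite -(sweedlerA _ FT) (linear_sum tassoc); apply: eq_bigr => q _.
rewrite [X in X ⊗ₜ _](val_can_flip_at h q.1) linear_sumlz (linear_sum tassoc).
by apply: eq_bigr => r _; rewrite /= tassocE.
Qed.

Lemma basis_components_bij (M : lmodType k) (f : {linear C ⊗ H -> M}) : bijective f ->
  bijective (fun x : {ffun 'I_(\dim {:H}) -> C} => \sum_i f (x i ⊗ₜ e`_i)).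
Proof.
move=> fB; apply: eq_bij (bij_comp fB (tensor_vbasis_bij C H)) _ _ => x /=.
exact: linear_sum.
Qed.

End Canonical.

Theorem proposition5p2 (k : fieldType) (H : finHopfAlgType k)
    (C : modCoalgType H) :
  coGalois C -> left_codepth_two (pbar C) /\ right_codepth_two (pbar C).
Proof.
move=> canB; split; exists (\dim {:H}); rewrite ?adim_gt0 //.
  apply: (@direct_summand_pow k (Cbar C) C (corestrl (pbar C) (cotensor (pbar C)))
    (corestrl (pbar C) (regular_bicomod C)) _
    (fun i => can_flip_at C (vbasis {:H})`_i)).
    by move=> i; exact: can_flip_at_bicolinear.
  exact: basis_components_bij (can_flip_bij canB).
apply: (@direct_summand_pow k C (Cbar C) (corestrr (pbar C) (cotensor (pbar C)))
  (corestrr (pbar C) (regular_bicomod C)) _ (fun i => can_at C (vbasis {:H})`_i)).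
  by move=> i; exact: can_at_bicolinear.
by apply: (@basis_components_bij _ _ _ _ (@can_lin _ _ C)).
Qed.
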